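(* Let $G=(\mathbb{Z}^d,E)$ be a lattice whose edge set $E$ is symmetric with respect to coordinate permutations and reflections. Then there exist constants $C>0$ and $c>0$ such that for any $r$ and any $z\in\partial Q_r$, $$\mathbf{P}_{p_c}\big(0\stackrel{Q_r}{\longleftrightarrow}z\big)\ge c\,e^{-C\log^2 r}.$$
   Context: A lattice is a graph embedded in $\mathbb{R}^d$ with vertex set $\mathbb{Z}^d$, with every vertex of finite degree, and with edge set $E$ periodic with respect to a group of translations spanning $\mathbb{R}^d$ (by linear combinations). Reflections are the maps changing the sign of one coordinate. $\mathbf{P}_p$ is Bernoulli bond percolation (each edge is independently open with probability $p$ and closed otherwise), and $p_c=\inf\{p:\mathbf{P}_p(\exists\text{ an infinite open component})>0\}$. Here $r$ is a positive integer, $Q_r=\{-r,\dots,r\}^d$, and $\partial Q_r=\{z\in Q_r:\exists x\notin Q_r\text{ with }(z,x)\in E\}$. $x\stackrel{A}{\longleftrightarrow}y$ means that $x$ and $y$ are joined by an open path contained in $A$. The constants $c,C$ depend only on $d$ and the lattice, not on $r$ or $z$. The lemma is for all dimensions $d$; no assumption on the two-point function is made.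
   Formalization: The lattice is assumed connected, and the bound is claimed only for z in ∂Q_r that can be reached from 0 by a path of edges of G (open or not) inside Q_r; otherwise the probability can be 0, e.g. d=1, edges {n,n+2},{n,n+3}, r=1, z=1. *)

(* Defs.v *)
From HB Require Import structures.
From mathcomp Require Import all_boot all_order all_algebra all_fingroup finmap.
From mathcomp Require Import all_classical all_reals all_analysis.
From mathcomp Require Import measurable_realfun.

Set Implicit Arguments.
Unset Strict Implicit.
Unset Printing Implicit Defensive.

Import Order.TTheory GRing.Theory Num.Theory.
Local Open Scope classical_set_scope.
Local Open Scope ring_scope.

(* There is an e-path from x to y all of whose vertices, x and y included,
   lie in A. *)
Definition joined (T : eqType) (e : rel T) (A : set T) (x y : T) : Prop :=
  exists s : seq T,
    [/\ path e x s, last x s = y & forall v, v \in x :: s -> A v].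

Section Lattices.
Variable d : nat.
Implicit Types (E : rel 'rV[int]_d) (x y z : 'rV[int]_d).

(* Real linear combinations of integer translation vectors fill R^d. *)
Definition spanning (R : realType) (L : set 'rV[int]_d) : Prop :=
  forall v : 'rV[R]_d, exists (n : nat) (a : 'I_n -> R) (t : 'I_n -> 'rV[int]_d),
    (forall i, L (t i)) /\ v = \sum_(i < n) a i *: map_mx intr (t i).

Record lattice (R : realType) E : Prop := Lattice {
  lattice_sym : symmetric E;
  lattice_irrefl : irreflexive E;
  lattice_finite_degree : forall x, finite_set [set y | E x y];
  lattice_periodic : exists L : set 'rV[int]_d,
    [/\ L 0, (forall s t, L s -> L t -> L (s - t)), spanning R L
      & forall t, L t -> forall x y, E (x + t) (y + t) = E x y]
}.

Definition reflection (i : 'I_d) x : 'rV[int]_d :=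
  \row_j (if j == i then - x 0 j else x 0 j).

Definition coordinate_symmetric E : Prop :=
  (forall (s : 'S_d) x y, E (col_perm s x) (col_perm s y) = E x y) /\
  (forall (i : 'I_d) x y, E (reflection i x) (reflection i y) = E x y).

Definition connected_graph E : Prop := forall x y, joined E setT x y.

Definition box (r : nat) : set 'rV[int]_d :=
  [set x | forall i, `|x 0 i| <= r%:Z].

(* A boundary vertex need not be reachable from 0 by edges of E staying in
   box r, even when E is connected: for d = 1 and edges {n, n + 2}, {n, n + 3},
   0 is isolated inside box 1. *)
Definition box_boundary E (r : nat) : set 'rV[int]_d :=
  [set z | box r z /\ exists x, ~ box r x /\ E z x].

Definition is_edge E : pred {fset 'rV[int]_d} :=
  fun e => `[< exists x y, E x y /\ e = [fset x; y]%fset >].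

Definition edge E := {e : {fset 'rV[int]_d} | is_edge E e}.

End Lattices.

Definition cylinders (I : Type) : set (set (I -> bool)) :=
  [set A | exists (i : I) (b : bool), A = [set w | w i = b]].

Definition config (I : Type) := g_sigma_algebraType (@cylinders I).

(* The finite-dimensional laws of i.i.d. Bernoulli(p) variables; they determine
   P on the product sigma-algebra. *)
Definition is_bernoulli_product (R : realType) (I : choiceType) (p : R)
    (P : probability (config I) R) : Prop :=
  forall (F : {fset I}) (eta : I -> bool),
    P [set w | forall i, i \in F -> w i = eta i] =
    (\prod_(i <- F) (if eta i then p else 1 - p))%:E.

(* Existence of the product measure: with u uniform on [0, 1], the successive
   digits of the expansion of u obtained by splitting [0, 1[ in proportions
   p : 1 - p at each step are i.i.d. Bernoulli(p). *)
Section Existence.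
Variables (R : realType) (I : countType) (p : R).
Hypothesis p01 : 0 <= p <= 1.

Let wt (b : bool) : R := if b then p else 1 - p.

Let step (u : R) : R := if u < p then p^-1 * u else (1 - p)^-1 * (u - p).
Let digit (k : nat) (u : R) : bool := iter k step u < p.

Let wt_ge0 b : 0 <= wt b.
Proof. by case/andP: p01 => ? ?; rewrite /wt; case: b; rewrite ?subr_ge0. Qed.

Let measurable_step : measurable_fun setT step.
Proof.
apply: measurable_fun_ifT.
- exact: measurable_fun_ltr.
- exact: measurable_funM.
- by apply: measurable_funM => //; apply: measurable_funB.
Qed.

Let measurable_digit k : measurable_fun setT (digit k).
Proof.
apply: measurable_fun_ltr => //.
elim: k => [|k IH]; first exact: measurable_id.
exact: (measurableT_comp measurable_step IH).
Qed.

Let expand (u : R) : config I := fun i => digit (choice.pickle i) u.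

Let measurable_expand : measurable_fun setT expand.
Proof.
apply: (@measurability _ _ _ (config I) _ _ (@cylinders I : set (set (config I)))) => //.
move=> _ [_ [i [b ->]] <-].
by apply: (measurable_digit (choice.pickle i) measurableT (Y := [set b])).
Qed.

Let D (s : seq (option bool)) : set R :=
  [set u | forall k b, nth None s k = Some b -> digit k u = b].

Let measurable_D s : measurable (D s).
Proof.
rewrite (_ : D s = \bigcap_k
    [set u | forall b, nth None s k = Some b -> digit k u = b]); last first.
  apply/seteqP; split=> [u Hu k _ b /Hu //|u Hu k b Hk].
  exact: (Hu k).
apply: bigcap_measurable => // k _.
case: (nth None s k) => [b|]; last first.
  by rewrite (_ : [set _ | _] = setT)//; apply/seteqP; split.
rewrite (_ : [set _ | _] = setT `&` digit k @^-1` [set b]); last first.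
  by apply/seteqP; split=> [u Hu|u [_ Hu] b' [<-]]; [split=> //; exact: Hu|].
exact: measurable_digit.
Qed.

Let D_interval (s : seq bool) : exists a : R,
  [/\ 0 <= a, a + \prod_(b <- s) wt b <= 1 &
    D (map Some s) `&` `[0, 1[%classic = `[a, a + \prod_(b <- s) wt b[%classic].
Proof.
elim: s => [|b s [a [a0 aw IH]]].
  exists 0; rewrite big_nil add0r; split=> //.
  by rewrite setIidr// => u _ k b; rewrite nth_nil.
have DE u : D (map Some (b :: s)) u <-> (u < p) = b /\ D (map Some s) (step u).
  split=> [Hu|[Hb Hu] [|k] b' /=].
  - split; first exact: (Hu 0%N b).
    by move=> k b' Hk; move: (Hu k.+1 b' Hk); rewrite /digit iterSr.
  - by case=> <-.
  - by move=> /Hu; rewrite /digit iterSr.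
have IHu v : 0 <= v < 1 -> D (map Some s) v <-> a <= v < a + \prod_(b <- s) wt b.
  move=> v01; have := congr1 (fun A => A v) IH => /= /propeqP.
  rewrite !in_itv/= => -[H1 H2]; split=> [?|/H2[]//]; exact: H1.
set w := \prod_(b <- s) wt b in aw IHu *.
have w0 : 0 <= w by apply: prodr_ge0 => b' _; exact: wt_ge0.
case/andP: p01 => p0 p1.
rewrite big_cons -/w; case: b DE => DE.
  exists (p * a); split.
  - exact: mulr_ge0.
  - by rewrite /wt -mulrDr mulr_ile1// addr_ge0.
  apply/seteqP; split=> u /=; rewrite !in_itv/=.
    case=> /DE[up]; rewrite /step up => Hu /andP[u0 u1].
    have pp : 0 < p by exact: le_lt_trans up.
    have := Hu => /IHu; rewrite mulr_ge0 ?invr_ge0//= ltr_pdivrMl// mulr1 up.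
    by move=> /(_ isT); rewrite /wt ler_pdivlMl// ltr_pdivrMl// mulrDr.
  rewrite /wt => /andP[u0 u1].
  have pp : 0 < p.
    rewrite lt_neqAle p0 andbT; apply/eqP => p00; move: u0 u1.
    by rewrite -p00 !mul0r addr0 => h1 /(le_lt_trans h1); rewrite ltxx.
  have up : u < p.
    by apply: lt_le_trans u1 _; rewrite -mulrDr ler_piMr.
  have u00 : 0 <= u by apply: le_trans u0; exact: mulr_ge0.
  split; last by rewrite u00 (lt_le_trans up).
  apply/DE; rewrite up; split=> //; rewrite /step up; apply/IHu.
    by rewrite mulr_ge0 ?invr_ge0//= ltr_pdivrMl// mulr1 up.
  by rewrite ler_pdivlMl// ltr_pdivrMl// mulrDr u0.
set q := 1 - p; have q0 : 0 <= q by rewrite subr_ge0.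
exists (p + q * a); rewrite -/q /wt -/q -addrA -mulrDr; split.
- by rewrite addr_ge0// mulr_ge0.
- by rewrite -lerBrDl -/q ler_piMr.
apply/seteqP; split=> u /=; rewrite !in_itv/=.
  case=> /DE[up]; rewrite /step up => Hu /andP[u0 u1].
  have pu : p <= u by rewrite leNgt up.
  have qq : 0 < q by rewrite subr_gt0 (le_lt_trans pu).
  have := Hu => /IHu; rewrite -/q mulr_ge0 ?invr_ge0 ?subr_ge0//= ltr_pdivrMl// mulr1.
  rewrite ltrD2r u1 => /(_ isT); rewrite ler_pdivlMl// ltr_pdivrMl//.
  by rewrite lerBrDl ltrBlDl.
move=> /andP[u0 u1].
have qq : 0 < q.
  rewrite lt_neqAle q0 andbT; apply/eqP => q00; move: u0 u1.
  by rewrite -q00 !mul0r addr0 => h1 /(le_lt_trans h1); rewrite ltxx.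
have pu : p <= u by apply: le_trans u0; rewrite lerDl mulr_ge0.
have ul : u < 1.
  by apply: lt_le_trans u1 _; rewrite -lerBrDl -/q ler_piMr.
split; last by rewrite (le_trans p0 pu).
apply/DE; rewrite ltNge pu /=; split=> //; rewrite /step ltNge pu /= -/q.
apply/IHu.
  by rewrite mulr_ge0 ?invr_ge0 ?subr_ge0//= ltr_pdivrMl// mulr1 ltrD2r.
by rewrite ler_pdivlMl// ltr_pdivrMl// lerBrDl ltrBlDl u0.
Qed.

Let U : probability _ R := uniform_prob (@ltr01 R).

Let U_itv (a b : R) : 0 <= a -> a <= b -> b <= 1 -> U `[a, b[%classic = (b - a)%:E.
Proof.
move=> a0 ab b1; rewrite /U /= /uniform_prob integral_uniform_pdf.
rewrite setIidl; last first.
  move=> u /=; rewrite !in_itv/= => /andP[au ub].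
  by rewrite (le_trans a0 au) (le_trans (ltW ub)).
rewrite (eq_integral (fun=> 1%:E)); last first.
  move=> u; rewrite inE/= in_itv/= => /andP[au ub]; rewrite /uniform_pdf.
  by rewrite (le_trans a0 au) (le_trans (ltW ub))// subr0 invr1.
rewrite integral_cst//= mul1e lebesgue_measure_itv/= lte_fin.
move: ab; rewrite le_eqVlt => /orP[/eqP->|->]; last by rewrite EFinB.
by rewrite ltxx subrr.
Qed.


Let U_restr A : measurable A -> U A = U (A `&` `[0, 1[%classic).
Proof.
pose B : set R := `[0, 1[%classic.
move=> mA; have U01 : U B = 1%:E by rewrite U_itv// subr0.
have mB : measurable B by exact: measurable_itv.
have h0 : U (A `\` B) = 0.
  apply/eqP; rewrite eq_le measure_ge0 andbT.
  have <- : U (~` B) = 0 by rewrite probability_setC// U01 subee.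
  by apply: le_measure; rewrite ?inE; [exact: measurableD|exact: measurableC|
    move=> u []].
rewrite (measureDI U mA mB) -[RHS]add0e; congr (_ + _)%E; exact: h0.
Qed.

Let U_D (t : seq (option bool)) (s : seq bool) :
  U (D (map Some s ++ t)) =
  (\prod_(o <- map Some s ++ t) oapp wt 1 o)%:E.
Proof.
elim: t s => [s|o t IH s].
  rewrite !cats0 (U_restr (measurable_D _)); have [a [a0 aw Ha]] := D_interval s.
  apply: (etrans (congr1 U Ha)); rewrite U_itv ?lerDl ?prodr_ge0//.
  by rewrite big_map addrAC subrr add0r.
case: o => [b|]; first by have := IH (rcons s b); rewrite map_rcons cat_rcons.
pose Db b := D (map Some (rcons s b) ++ t).
have -> : D (map Some s ++ None :: t) = Db true `|` Db false.
  apply/seteqP; split=> u.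
    move=> Hu; have : Db (digit (size s) u) u.
      move=> k b; rewrite map_rcons cat_rcons nth_cat size_map.
      case: ltnP => [ks Hk|]; first by apply: Hu; rewrite nth_cat size_map ks.
      rewrite leq_eqVlt => /predU1P[<-|sk]; first by rewrite subnn => -[].
      move=> Hk; apply: Hu; rewrite nth_cat size_map ltnNge (ltnW sk)/=.
      by move: Hk; rewrite -(subnSK sk).
    by case: (digit _ _); [left|right].
  have h b : Db b u -> D (map Some s ++ None :: t) u.
    move=> Hu k c Hk; apply: Hu; move: Hk.
    rewrite map_rcons cat_rcons !nth_cat size_map; case: ltnP => // sk.
    by case: (k - size s)%N.
  by case; exact: h.
have disj : Db true `&` Db false = set0.
  apply/seteqP; split=> // u [/(_ (size s) true) Ht /(_ (size s) false) Hf].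
  move: Ht Hf; rewrite !map_rcons !cat_rcons !nth_cat size_map ltnn subnn/=.
  by move=> /(_ erefl) -> /(_ erefl).
apply: (etrans (measureU U (measurable_D _) (measurable_D _) disj)).
apply: (etrans (congr2 (fun a b : \bar R => (a + b)%E) (IH _) (IH _))).
rewrite !map_rcons !cat_rcons !big_cat !big_cons/= -EFinD; congr _%:E.
by rewrite mul1r !mulrA -mulrDl -mulrDr addrC subrK mulr1.
Qed.

Lemma bernoulli_product_exists01 :
  exists P : probability (config I) R, is_bernoulli_product p P.
Proof.
have mX : measurable_fun (setT : set (measurableTypeR R)) expand.
  exact: measurable_expand.
pose X : {mfun measurableTypeR R >-> config I} :=
  @mfun_Sub _ _ (measurableTypeR R) (config I) expand (mem_set mX).
exists (distribution U X) => F eta.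
pose c k := if @pickle_inv I k is Some i then
  if i \in F then Some (eta i) else None else None.
pose N := (\sum_(i <- F) (choice.pickle i).+1)%N.
have FN i : i \in F -> (choice.pickle i < N)%N.
  by move=> iF; rewrite /N (big_rem i)//= leq_addr.
transitivity (U (D (mkseq c N))).
  congr (U _); apply/seteqP; split=> u /=.
    move=> Hu k b; have [kN|kN] := ltnP k N; last first.
      by rewrite nth_default// size_mkseq.
    rewrite nth_mkseq// /c; have := @pickle_invK I k.
    case: (pickle_inv k) => //= i <-; case: ifPn => // iF [<-].
    exact: Hu.
  move=> Hu i iF; apply: (Hu (choice.pickle i)).
  by rewrite nth_mkseq ?FN// /c pickleK_inv iF.
have := U_D (mkseq c N) [::]; rewrite /= => ->; congr _%:E.
rewrite big_map.
rewrite (bigID (fun k => k \in map choice.pickle F))/= [X in _ * X]big1 ?mulr1.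
  rewrite -big_filter (perm_big (map choice.pickle F)).
    rewrite big_map big_seq [RHS]big_seq; apply: eq_bigr => i iF.
    by rewrite /c pickleK_inv iF.
  apply: uniq_perm.
  - by rewrite filter_uniq// iota_uniq.
  - by rewrite map_inj_uniq ?fset_uniq//; exact: (pcan_inj pickleK_inv).
  move=> k; rewrite mem_filter mem_iota add0n/=.
  apply/andb_idr => /mapP[i iF ->]; exact: FN.
move=> k kF; rewrite /c; have := @pickle_invK I k.
case: (pickle_inv k) => //= i ik; case: ifPn => // iF.
by move: kF; rewrite -ik map_f.
Qed.

End Existence.

Lemma bernoulli_product_exists (R : realType) (I : countType) (p : R) :
  exists P : probability (config I) R,
    0 <= p <= 1 -> is_bernoulli_product p P.
Proof.
have [p01|p01] := boolP (0 <= p <= 1).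
  by have [P HP] := bernoulli_product_exists01 I p01; exists P.
have h : 0 <= (0 : R) <= 1 by rewrite lexx ler01.
by have [P _] := bernoulli_product_exists01 I h; exists P.
Qed.

(* Unspecified for p outside [0, 1]. *)
Definition bernoulli_product (R : realType) (I : countType) (p : R) :
  probability (config I) R := sval (cid (bernoulli_product_exists I p)).

Lemma bernoulli_productP (R : realType) (I : countType) (p : R) :
  0 <= p <= 1 -> is_bernoulli_product p (bernoulli_product I p).
Proof. exact: svalP (cid (bernoulli_product_exists I p)). Qed.

Section Percolation.
Variables (R : realType) (d : nat) (E : rel 'rV[int]_d).
Implicit Types (w : config (edge E)) (p : R).

Definition open_adj w : rel 'rV[int]_d :=
  fun x y => oapp w false (insub [fset x; y]%fset : option (edge E)).

Definition open_connection (A : set 'rV[int]_d) (x y : 'rV[int]_d) :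
    set (config (edge E)) := [set w | joined (open_adj w) A x y].

Definition open_component w (x : 'rV[int]_d) : set 'rV[int]_d :=
  [set y | joined (open_adj w) setT x y].

Definition percolation p : probability (config (edge E)) R :=
  bernoulli_product (edge E) p.

Definition infinite_open_component : set (config (edge E)) :=
  [set w | exists x, infinite_set (open_component w x)].

Definition p_c : R :=
  inf [set p | 0 <= p <= 1 /\ (0 < percolation p infinite_open_component)%E].

End Percolation.

(* Main.v *)
Require Import Defs.
From mathcomp Require Import all_boot all_order all_algebra all_fingroup finmap.
From mathcomp Require Import all_classical all_reals all_analysis.
From mathcomp Require Import zify ring lra.

Set Implicit Arguments.
Unset Strict Implicit.
Unset Printing Implicit Defensive.

Import Order.TTheory GRing.Theory Num.Theory.
Import numFieldNormedType.Exports.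
Local Open Scope classical_set_scope.
Local Open Scope ring_scope.

(** If P_p percolates then, for every n, some vertex near 0 is joined inside Q_n
to some boundary vertex of Q_n with probability at least c n^(-C): a path from x
to infinity crosses Q_n, and the part after its last visit to Q_n uses disjoint
edges, so a smaller crossing probability would make the one-arm probabilities
decay geometrically in the number of scales. By continuity in p of finitely
supported events the bound holds at p_c, and it forces p_c > 0.

By Harris' inequality, gluing this crossing to its mirror image joins 0 to a
point of the axis at distance of order n inside Q_(4n), again with polynomial
probability. Starting from a vertex w of Q_r, moves at a scale proportional to
the distance from w to the boundary of Q_r, and then to the distance from w to
0, reach 0 after O(log r) moves, each costing at most a power of r. *)

(** * Finitely supported events *)

(** Translations preserve [E] only along multiples of some [m], so a crossing starts at an unknown
    vertex of Q_m and every gluing must be completed by a bounded path; its cost is a constant only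
    because p_c > 0. Moreover percolation is known at parameters close to p_c, not at p_c, and the
    endpoints of the crossing vary with p; continuity is therefore applied to a sum over all pairs
    of endpoints, which costs another power of n.

    The end of a crossing is controlled in one coordinate only. Its mirror image across that axis
    has the same other coordinates, so the unknown ones cancel when the two copies are glued.

    A move needs room proportional to its length, which is why the scale must follow the distance to
    the boundary and grow geometrically. The vertex z itself has no room at all: a path of bounded
    length inside Q_r, with a bound uniform in r and z, leads it to a fixed depth where moves become
    possible. The final product of O(log r) factors of order r^(-b) is the source of log^2 r. *)

Section FiniteAverages.
Variables (R : realType) (I : eqType).
Implicit Types (p : R) (w v : I -> bool) (s : seq I) (f g : (I -> bool) -> R).

Definition update w i b : I -> bool := fun j => if j == i then b else w j.

(** Expectation of [f] when the coordinates in [s] are resampled as independent Bernoulli(p) bits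
    and the others are frozen at [w]. Independence, Harris' inequality and continuity in [p] become
    inductions on [s], free of measure theory. *)
Fixpoint avg p s f w : R :=
  if s is i :: s' then
    p * avg p s' f (update w i true) + (1 - p) * avg p s' f (update w i false)
  else f w.

Definition ignores f i := forall w b, f (update w i b) = f w.

Lemma update_update w i b c : update (update w i b) i c = update w i c.
Proof. by apply/funext => j; rewrite /update; case: eqP. Qed.

Lemma updateC w i j b c : i != j ->
  update (update w i b) j c = update (update w j c) i b.
Proof.
move=> ij; apply/funext => k; rewrite /update.
by have [->|//] := eqVneq k j; rewrite eq_sym (negbTE ij).
Qed.

Lemma avg_ignores p s f i : ignores f i -> ignores (avg p s f) i.
Proof.
move=> fi; elim: s => [//|j s IH] w b /=.
have [->|ij] := eqVneq i j; first by rewrite !update_update.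
by rewrite !(updateC _ _ _ ij) !IH.
Qed.

(** At each coordinate one of the two factors does not see the outcome, so it comes out of the
    two-term sum. *)
Lemma avg_indep p s f g w : {in s, forall i, ignores f i \/ ignores g i} ->
  avg p s (f \* g) w = avg p s f w * avg p s g w.
Proof.
elim: s w => [//|i s IH] w H /=.
have Hs : {in s, forall i, ignores f i \/ ignores g i}.
  by move=> j js; apply: H; rewrite inE js orbT.
rewrite !IH//; have [|fi|gi] := H i; first by rewrite mem_head.
- by rewrite !(avg_ignores p s fi); ring.
- by rewrite !(avg_ignores p s gi); ring.
Qed.

Definition increasing f := forall w v, (forall i, w i -> v i) -> f w <= f v.

Lemma avg_increasing p s f : 0 <= p <= 1 -> increasing f ->
  increasing (avg p s f).
Proof.
move=> /andP[p0 p1] fi; elim: s => [//|i s IH] w v wv /=.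
apply: lerD; apply: ler_wpM2l; rewrite ?subr_ge0//; apply: IH => j;
  by rewrite /update; case: eqP => // _; exact: wv.
Qed.

(** For a single coordinate the covariance of the two conditional averages is p(1-p)(F1 - F0)(G1 -
    G0), and both differences are nonnegative because averaging preserves monotonicity. *)
Lemma avg_harris p s f g w : 0 <= p <= 1 -> increasing f -> increasing g ->
  avg p s f w * avg p s g w <= avg p s (f \* g) w.
Proof.
move=> p01 fi gi; elim: s w => [//|i s IH] w /=.
have /andP[p0 p1] := p01; have q0 : 0 <= 1 - p by rewrite subr_ge0.
apply: le_trans (lerD (ler_wpM2l p0 (IH _)) (ler_wpM2l q0 (IH _))).
have le01 h : increasing h ->
    0 <= avg p s h (update w i true) - avg p s h (update w i false).
  move=> hi; rewrite subr_ge0; apply: avg_increasing => // j.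
  by rewrite /update; case: eqP.
move: (le01 f fi) (le01 g gi).
set F1 := avg p s f _; set F0 := avg p s f _.
set G1 := avg p s g _; set G0 := avg p s g _ => Fi Gi.
rewrite -subr_ge0.
rewrite (_ : _ - _ = p * (1 - p) * ((F1 - F0) * (G1 - G0))); last by ring.
by rewrite !mulr_ge0.
Qed.

Lemma avg_map p s f (t : I -> I) w : injective t ->
  avg p (map t s) (fun v => f (v \o t)) w = avg p s f (w \o t).
Proof.
move=> tinj; elim: s w => [//|i s IH] w /=; rewrite !IH.
have ut b : update w (t i) b \o t = update (w \o t) i b.
  by apply/funext => j /=; rewrite /update (inj_eq tinj).
by rewrite !ut.
Qed.

Lemma continuous_avg s f w : continuous (fun p => avg p s f w).
Proof.
elim: s w => [|i s IH] w p /=; first exact: cst_continuous.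
apply: cvgD; apply: cvgM; try exact: IH; first exact: cvg_id.
by apply: cvgB; [exact: cvg_cst|exact: cvg_id].
Qed.

End FiniteAverages.

(** * Probabilities of events depending on finitely many coordinates *)

Section FiniteEvents.
Variables (R : realType) (I : countType).
Implicit Types (p : R) (w v : I -> bool) (s F : seq I) (A B : set (config I)).

Definition depends_on s A :=
  forall w v, {in s, w =1 v} -> A w -> A v.

Definition finite_event A := exists s, depends_on s A.

Definition increasing_event A :=
  forall w v, (forall i, w i -> v i) -> A w -> A v.

Lemma depends_onS s F A : {subset s <= F} -> depends_on s A -> depends_on F A.
Proof. by move=> sF sA w v wv; apply: sA => i /sF; exact: wv. Qed.

Definition indicator A w : R := `[< A w >]%:R.

Lemma indicatorI A B : indicator (A `&` B) = indicator A \* indicator B.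
Proof.
apply/funext => w; rewrite /indicator/=.
by rewrite -natrM mulnb -asbool_and.
Qed.

Lemma indicator_increasing A : increasing_event A -> increasing (indicator A).
Proof.
move=> Ai w v wv; rewrite /indicator ler_nat.
by case: asboolP => // /(Ai _ _ wv) ?; rewrite asboolT.
Qed.

Lemma indicator_ignores s A i : depends_on s A -> i \notin s ->
  ignores (indicator A) i.
Proof.
move=> sA si w b; congr (_%:R); congr nat_of_bool; apply/asbool_equiv_eq.
have E : {in s, update w i b =1 w}.
  by move=> j js; rewrite /update; case: eqP => // ji; rewrite -ji js in si.
by split; apply: sA => // j js; rewrite E.
Qed.

Lemma measurable_coordinate i b : measurable ([set w | w i = b] : set (config I)).
Proof. by apply: sub_sigma_algebra; exists i, b. Qed.

Lemma finite_event_measurable A : finite_event A -> measurable A.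
Proof.
case=> s; elim: s A => [|i s IH] A sA.
  have [[w Aw]|nA] := pselect (exists w, A w).
    rewrite (_ : A = setT); first exact: measurableT.
    by apply/seteqP; split=> // v _; exact: sA Aw.
  rewrite (_ : A = set0); first exact: measurable0.
  by apply/seteqP; split=> // v Av; apply: nA; exists v.
pose Ab b : set (config I) := [set w | A (update w i b)].
have mAb b : measurable (Ab b).
  apply: IH => w v wv; apply: sA => j; rewrite inE /update.
  by case: eqP => //= _; exact: wv.
have updE w : update w i (w i) = w.
  by apply/funext => j; rewrite /update; case: eqP => // ->.
rewrite (_ : A = ([set w | w i = true] `&` Ab true) `|`
                 ([set w | w i = false] `&` Ab false)).
  by apply: measurableU; apply: measurableI => //; exact: measurable_coordinate.
apply/seteqP; split=> w /=.
  by case wi: (w i) => Aw; [left|right]; rewrite /Ab/= -wi updE.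
by case=> -[wi]; rewrite /Ab/= -wi updE.
Qed.

Lemma finite_eventI A B : finite_event A -> finite_event B ->
  finite_event (A `&` B).
Proof.
move=> [s sA] [t tB]; exists (s ++ t) => w v wv [Aw Bw]; split.
- by apply: sA Aw => i si; apply: wv; rewrite mem_cat si.
- by apply: tB Bw => i ti; apply: wv; rewrite mem_cat ti orbT.
Qed.

Lemma finite_event_bigcup (T : eqType) (t : seq T) (A : T -> set (config I)) :
  (forall x, x \in t -> finite_event (A x)) ->
  finite_event [set w | exists2 x, x \in t & A x w].
Proof.
elim: t => [|x t IH] H; first by exists [::] => w v _ [].
have [s sA] := H x (mem_head _ _).
have [y yt|u uA] := IH; first by apply: H; rewrite inE yt orbT.
exists (s ++ u) => w v wv [y]; rewrite inE => /predU1P[->|yt] Ay.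
  exists x; first by rewrite mem_head.
  by apply: sA Ay => i si; apply: wv; rewrite mem_cat si.
have [||z zt Az] := uA w v; last by exists z; rewrite // inE zt orbT.
- by move=> i iu; apply: wv; rewrite mem_cat iu orbT.
- by exists y.
Qed.

Definition cylinder F w : set (config I) :=
  [set v | forall i, i \in F -> v i = w i].

Section Product.
Variables (p : R) (P : probability (config I) R).
Hypothesis HP : is_bernoulli_product p P.

Lemma cylinder_prob F w : uniq F ->
  P (cylinder F w) = (\prod_(i <- F) (if w i then p else 1 - p))%:E.
Proof.
move=> uF; have := HP [fset i in F]%fset w.
rewrite (_ : [set _ | _] = cylinder F w).
  move=> ->; congr _%:E; apply: perm_big; apply: uniq_perm => //.
  by move=> i; rewrite inE.
by apply/seteqP; split=> v /= H i; have := H i; rewrite inE/=.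
Qed.

(** Bridge between the measure, known only on cylinders, and [avg]. The coordinates of [F] are
    already revealed; the induction reveals those of [s], splitting the event according to the value
    of the next one. *)
Lemma cylinder_avg s F A w : uniq (F ++ s) -> depends_on (F ++ s) A ->
  P (cylinder F w `&` A) =
  (\prod_(i <- F) (if w i then p else 1 - p) * avg p s (indicator A) w)%:E.
Proof.
elim: s F w => [|i s IH] F w.
  rewrite cats0 => uF FA /=; rewrite /indicator; case: asboolP => Aw.
    rewrite mulr1 -cylinder_prob//; congr (P _); apply/seteqP; split=> v /=.
      by case.
    by move=> vw; split=> //; apply: FA Aw => j jF; rewrite vw.
  rewrite mulr0 -[RHS](measure0 P); congr (P _); apply/seteqP; split=> v //=.
  by case=> vw Av; apply: Aw; exact: FA Av.
move=> uFs FA.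
have pe : perm_eq (F ++ i :: s) ((i :: F) ++ s) by rewrite perm_catC/= perm_cons perm_catC.
have u1 : uniq ((i :: F) ++ s) by rewrite -(perm_uniq pe).
have d1 : depends_on ((i :: F) ++ s) A.
  by apply: depends_onS FA => j; rewrite (perm_mem pe).
have iF : i \notin F.
  by move: u1; rewrite /= mem_cat negb_or => /andP[/andP[]].
pose D b : set (config I) := cylinder (i :: F) (update w i b) `&` A.
have Df b : finite_event (D b).
  apply: finite_eventI; last by exists ((i :: F) ++ s).
  by exists (i :: F) => v v' vv' H j jF; rewrite -vv'// H.
have DE : cylinder F w `&` A = D true `|` D false.
  apply/seteqP; split=> v /=.
    case=> vw Av; case vi: (v i); [left|right]; split=> //= j; rewrite inE /update;
      by case: eqP => [->//|_ /= jF]; rewrite vw.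
  case=> -[H Av]; split=> // j jF; have := H j; rewrite inE jF orbT /update;
    by case: eqP => [ji|_ ->//]; rewrite -ji jF in iF.
have D0 : D true `&` D false = set0.
  apply/seteqP; split=> // v [[/(_ i) H1 _] [/(_ i) H2 _]].
  by move: H1 H2; rewrite mem_head /update eqxx => -> // /(_ isT).
have mD b : measurable (D b) by exact: finite_event_measurable.
have IHb b := IH (i :: F) (update w i b) u1 d1.
rewrite DE; apply: (etrans (measureU P (mD true) (mD false) D0)).
apply: (etrans (congr2 (fun a b : \bar R => (a + b)%E) (IHb true) (IHb false))).
rewrite -EFinD; congr _%:E.
have wt b : \prod_(j <- i :: F) (if update w i b j then p else 1 - p) =
    (if b then p else 1 - p) * \prod_(j <- F) (if w j then p else 1 - p).
  rewrite big_cons {1}/update eqxx; congr (_ * _).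
  rewrite !big_seq; apply: eq_bigr => j jF; rewrite /update.
  by case: eqP => // ji; rewrite -ji jF in iF.
by rewrite !wt/=; ring.
Qed.

Lemma prob_avg s A w : uniq s -> depends_on s A ->
  P A = (avg p s (indicator A) w)%:E.
Proof.
move=> us sA; have := @cylinder_avg s [::] A w us sA.
rewrite big_nil mul1r => <-; congr (P _).
by apply/seteqP; split=> v; [|case].
Qed.

End Product.

Definition pr p A : R := fine (bernoulli_product I p A).

Section Pr.
Variable p : R.
Hypothesis p01 : 0 <= p <= 1.

Lemma prE A : measurable A -> bernoulli_product I p A = (pr p A)%:E.
Proof. by move=> mA; rewrite fineK// fin_num_measure. Qed.

Lemma pr_avg s A w : uniq s -> depends_on s A ->
  pr p A = avg p s (indicator A) w.
Proof.
by move=> us sA; rewrite /pr (prob_avg (@bernoulli_productP R I p p01) w us sA).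
Qed.

Lemma pr_ge0 A : 0 <= pr p A.
Proof. by rewrite fine_ge0// measure_ge0. Qed.

Lemma pr_le1 A : measurable A -> pr p A <= 1.
Proof. by move=> mA; rewrite -lee_fin -prE// probability_le1. Qed.

Lemma le_pr A B : measurable A -> measurable B -> A `<=` B -> pr p A <= pr p B.
Proof.
by move=> mA mB AB; rewrite -lee_fin -!prE//; apply: le_measure; rewrite ?inE.
Qed.

Lemma pr_harris A B : finite_event A -> finite_event B ->
  increasing_event A -> increasing_event B ->
  pr p A * pr p B <= pr p (A `&` B).
Proof.
move=> [s sA] [t tB] Ai Bi; pose u := undup (s ++ t).
have uA : depends_on u A.
  by apply: depends_onS sA => i si; rewrite mem_undup mem_cat si.
have uB : depends_on u B.
  by apply: depends_onS tB => i ti; rewrite mem_undup mem_cat ti orbT.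
have uAB : depends_on u (A `&` B).
  by move=> w v wv [Aw Bw]; split; [exact: uA Aw|exact: uB Bw].
have uu : uniq u by exact: undup_uniq.
pose w0 : I -> bool := fun=> false.
rewrite (pr_avg w0 uu uA) (pr_avg w0 uu uB) (pr_avg w0 uu uAB) indicatorI.
by apply: avg_harris => //; exact: indicator_increasing.
Qed.

Lemma pr_indep s t A B : depends_on s A -> depends_on t B ->
  {in s, forall i, i \notin t} -> pr p (A `&` B) = pr p A * pr p B.
Proof.
move=> sA tB st; pose u := undup (s ++ t).
have uA : depends_on u A.
  by apply: depends_onS sA => i si; rewrite mem_undup mem_cat si.
have uB : depends_on u B.
  by apply: depends_onS tB => i ti; rewrite mem_undup mem_cat ti orbT.
have uAB : depends_on u (A `&` B).
  by move=> w v wv [Aw Bw]; split; [exact: uA Aw|exact: uB Bw].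
have uu : uniq u by exact: undup_uniq.
pose w0 : I -> bool := fun=> false.
rewrite (pr_avg w0 uu uA) (pr_avg w0 uu uB) (pr_avg w0 uu uAB) indicatorI.
apply: avg_indep => i _; have [si|si] := boolP (i \in s).
  by right; apply: (indicator_ignores tB); exact: st.
by left; exact: (indicator_ignores sA).
Qed.

Lemma pr_reindex A (t : I -> I) : injective t -> finite_event A ->
  pr p [set w : config I | A (fun i => w (t i))] = pr p A.
Proof.
move=> tinj [s0 s0A]; pose s := undup s0.
have sA : depends_on s A by apply: depends_onS s0A => i; rewrite mem_undup.
have us : uniq s by exact: undup_uniq.
have tA : depends_on (map t s) [set w : config I | A (fun i => w (t i))].
  by move=> w v wv; apply: sA => i si /=; rewrite wv// map_f.
pose w0 : I -> bool := fun=> false.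
rewrite (pr_avg w0 _ tA) ?map_inj_uniq// (pr_avg (w0 \o t) us sA).
exact: (avg_map p s (indicator A) w0 tinj).
Qed.

Lemma pr_all_open s : p ^+ size s <= pr p [set w : config I | forall i, i \in s -> w i].
Proof.
have us := undup_uniq s.
rewrite (_ : [set _ | _] = cylinder (undup s) (fun=> true)); last first.
  by apply/seteqP; split=> w H i; have := H i; rewrite mem_undup.
have /andP[p0 p1] := p01.
rewrite /pr (cylinder_prob (@bernoulli_productP R I p p01))//= big_const_seq count_predT.
rewrite iter_mulr_1; apply: ler_wiXn2l => //; exact: size_undup.
Qed.

(** Serves at [p = 0], where the right-hand side vanishes. *)
Lemma pr_some_open s :
  pr p [set w : config I | ~ (forall i, i \in s -> ~~ w i)] <=
  1 - (1 - p) ^+ size s.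
Proof.
set A := [set w : config I | forall i, i \in s -> ~~ w i].
have mA : measurable A.
  by apply: finite_event_measurable; exists s => w v wv H i si; rewrite -wv ?H.
have Ap : (1 - p) ^+ size s <= pr p A.
  rewrite (_ : A = cylinder (undup s) (fun=> false)); last first.
    apply/seteqP; split=> w H i; have := H i; rewrite mem_undup;
      by case: (w i) => // h /h.
  have /andP[p0 p1] := p01.
  rewrite /pr (cylinder_prob (@bernoulli_productP R I p p01)) ?undup_uniq//=.
  rewrite big_const_seq count_predT iter_mulr_1.
  by apply: ler_wiXn2l; rewrite ?subr_ge0// ?gerBl//; exact: size_undup.
have := probability_setC (bernoulli_product I p) mA.
rewrite (prE mA) -EFinB => pC.
rewrite (_ : pr p _ = 1 - pr p A); last exact: (congr1 fine pC).
by rewrite lerD2l lerN2.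
Qed.

Lemma pr_union (T : eqType) (t : seq T) A (B : T -> set (config I)) :
  measurable A -> (forall x, x \in t -> finite_event (B x)) ->
  (forall w, A w -> exists2 x, x \in t & B x w) ->
  pr p A <= \sum_(x <- t) pr p (B x).
Proof.
move=> mA fB AB.
apply: (@le_trans _ _ (pr p [set w | exists2 x, x \in t & B x w])).
  apply: le_pr => //; apply: finite_event_measurable.
  exact: finite_event_bigcup.
elim: t fB {AB} => [|x t IH] fB.
  rewrite big_nil (_ : [set _ | _] = set0) /pr ?measure0//.
  by apply/seteqP; split=> // w [].
have fBt y : y \in t -> finite_event (B y) by move=> yt; apply: fB; rewrite inE yt orbT.
have mx : measurable (B x) by apply: finite_event_measurable; exact: fB (mem_head _ _).
have mt := finite_event_measurable (finite_event_bigcup fBt).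
rewrite big_cons; apply: le_trans (lerD (lexx _) (IH fBt)).
rewrite (_ : [set _ | _] = B x `|` [set w | exists2 x, x \in t & B x w]).
  by rewrite -lee_fin EFinD -!prE ?measureU2//; exact: measurableU.
apply/seteqP; split=> w /=.
  by case=> y; rewrite inE => /predU1P[->|yt] By; [left|right; exists y].
by case=> [Bx|[y yt By]]; [exists x; rewrite ?mem_head|exists y; rewrite // inE yt orbT].
Qed.

End Pr.

(** The measure is unspecified for [p] outside [0, 1], so continuity is expressed by a polynomial
    function that agrees with the probability on [0, 1]. *)
Lemma continuous_pr A : finite_event A ->
  exists2 g : R -> R, continuous g & forall p, 0 <= p <= 1 -> pr p A = g p.
Proof.
move=> [s0 s0A]; pose s := undup s0.
have sA : depends_on s A by apply: depends_onS s0A => i; rewrite mem_undup.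
exists (fun p => avg p s (indicator A) (fun=> false)); first exact: continuous_avg.
by move=> p p01; apply: (pr_avg p01) => //; exact: undup_uniq.
Qed.

End FiniteEvents.

(** * Open connections *)

Section Joined.
Variable T : eqType.
Implicit Types (e : rel T) (A B : set T) (x y z : T) (n : nat).

(** Lengths are tracked because a path of at most [n] edges is open with probability at least
    p^n. *)
Definition joined_le n e A x y := exists s : seq T,
  [/\ path e x s, last x s = y, forall v, v \in x :: s -> A v
    & (size s <= n)%N].

Lemma joined_leW n e A x y : joined_le n e A x y -> joined e A x y.
Proof. by case=> s [*]; exists s. Qed.

Lemma joined_ex n0 e A x y : joined e A x y ->
  exists2 n, (n0 <= n)%N & joined_le n e A x y.
Proof.
case=> s [*]; exists (n0 + size s)%N; first exact: leq_addr.
by exists s; split; rewrite // leq_addl.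
Qed.

Lemma joined_le_mono n n' e A x y : (n <= n')%N ->
  joined_le n e A x y -> joined_le n' e A x y.
Proof. by move=> nn' [s [? ? ? sn]]; exists s; split=> //; exact: leq_trans nn'. Qed.

Lemma joined_le_map n e e' A A' (g : T -> T) x y :
  (forall u v, A u -> A v -> e u v -> e' (g u) (g v)) ->
  (forall v, A v -> A' (g v)) ->
  joined_le n e A x y -> joined_le n e' A' (g x) (g y).
Proof.
move=> ge gA [s [es <- sA sn]]; exists (map g s); split.
- elim: s x es sA {sn} => //= u s IH x /andP[xu us] sA.
  have Ax : A x by apply: sA; rewrite mem_head.
  have Au : A u by apply: sA; rewrite !inE eqxx orbT.
  rewrite ge//= IH// => v vs.
  by apply: sA; rewrite inE vs orbT.
- by rewrite last_map.
- by rewrite -map_cons => _ /mapP[v /sA/gA ? ->].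
- by rewrite size_map.
Qed.

Lemma joined_map e e' A A' (g : T -> T) x y :
  (forall u v, A u -> A v -> e u v -> e' (g u) (g v)) ->
  (forall v, A v -> A' (g v)) ->
  joined e A x y -> joined e' A' (g x) (g y).
Proof.
by move=> ge gA /(joined_ex 0)[n _] H; exact: (joined_leW (joined_le_map ge gA H)).
Qed.

Lemma joined_sub e A A' x y : A `<=` A' -> joined e A x y -> joined e A' x y.
Proof. by move=> AA'; exact: (@joined_map e e A A' id). Qed.

Lemma joined_refl e A x : A x -> joined e A x x.
Proof. by move=> Ax; exists [::]; split=> // v; rewrite inE => /eqP->. Qed.

Lemma joined_endr e A x y : joined e A x y -> A y.
Proof. by case=> s [_ <-]; apply; rewrite mem_last. Qed.

Lemma joined_trans e A x y z :
  joined e A x y -> joined e A y z -> joined e A x z.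
Proof.
move=> [s [es <- sA]] [t [et <- tA]]; exists (s ++ t); split.
- by rewrite cat_path es.
- by rewrite last_cat.
move=> v; rewrite -cat_cons mem_cat => /orP[/sA//|vt].
by apply: tA; rewrite inE vt orbT.
Qed.

Lemma joined_edge e A x y : A x -> A y -> e x y -> joined e A x y.
Proof.
move=> Ax Ay xy; exists [:: y]; split; rewrite //= ?xy// => v.
by rewrite !inE => /orP[]/eqP->.
Qed.

Lemma joined_sym e A x y : symmetric e -> joined e A x y -> joined e A y x.
Proof.
move=> es [s [se <- sA]]; exists (rev (belast x s)); split.
- rewrite rev_path; apply: sub_path se => u v; by rewrite es.
- by case: s {se sA} => [|u s] //=; rewrite rev_cons last_rcons.
move=> v; rewrite inE mem_rev => /predU1P[->|/mem_belast]; first exact/sA/mem_last.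
exact: sA.
Qed.

Lemma joined_le_card (vs : seq T) e A x y : A `<=` [set` vs] ->
  joined e A x y -> joined_le (size vs) e A x y.
Proof.
move=> Avs [s [es <- sA]]; case/shortenP: es => s' es' us' ss'.
have s'A : forall v, v \in x :: s' -> A v.
  move=> v; rewrite inE => /predU1P[->|/ss' vs']; apply: sA; first exact: mem_head.
  by rewrite inE vs' orbT.
exists s'; split=> //; rewrite -ltnS ltnW// ltnS.
by apply: (@uniq_leq_size _ (x :: s')) => // v /s'A /Avs.
Qed.

Lemma first_exit e A B x y : A x -> ~ A y -> joined e B x y ->
  exists u v, [/\ joined e (A `&` B) x u, e u v, ~ A v & B v].
Proof.
move=> Ax nAy [s [es sy sB]].
elim: s x Ax es sy sB => [|z s IH] x Ax /=; first by move=> _ xy; rewrite -xy in nAy.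
move=> /andP[xz zs] sy sB.
have Bx : B x by apply: sB; rewrite mem_head.
have Bz : B z by apply: sB; rewrite !inE eqxx orbT.
have [Az|nAz] := pselect (A z); last first.
  by exists x, z; split=> //; exact: joined_refl.
have [v vs|u [v [zu uv nAv Bv]]] := IH z Az zs sy.
  by apply: sB; rewrite inE vs orbT.
exists u, v; split=> //; apply: joined_trans zu.
exact: joined_edge.
Qed.

(** This is the first exit of the reversed path from the complement of [A]. *)
Lemma last_exit e A B x y : symmetric e -> A x -> ~ A y -> joined e B x y ->
  exists u v, [/\ A u, e u v & joined e (~` A `&` B) v y].
Proof.
move=> es Ax nAy /(joined_sym es) yx.
have nnAx : ~ (~` A) x by apply.
have [v [u [yv vu /contrapT Au _]]] := @first_exit e (~` A) B y x nAy nnAx yx.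
by exists u, v; split=> //; [rewrite es|exact: joined_sym yv].
Qed.

End Joined.

Section OpenConnections.
Variables (R : realType) (d : nat) (E : rel 'rV[int]_d).
Hypotheses (Esym : symmetric E) (Eirr : irreflexive E).
Implicit Types (w : config (edge E)) (A B : set 'rV[int]_d)
  (x y z : 'rV[int]_d) (vs : seq 'rV[int]_d).

Lemma is_edge_pair x y : is_edge E [fset x; y]%fset = E x y.
Proof.
apply/asboolP/idP => [[a [b [ab]]] xyE|xy]; last by exists x, y.
have nab : a != b by apply/eqP => ab'; rewrite ab' Eirr in ab.
have xab : x \in [fset a; b]%fset by rewrite -xyE fset21.
have yab : y \in [fset a; b]%fset by rewrite -xyE fset22.
have aab : a \in [fset x; y]%fset by rewrite xyE fset21.
have bab : b \in [fset x; y]%fset by rewrite xyE fset22.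
move: xab yab aab bab; rewrite !in_fset2.
case/orP=> /eqP->; case/orP=> /eqP-> //.
- by rewrite !orbb => _ /eqP ba; rewrite ba eqxx in nab.
- by rewrite Esym.
- by rewrite !orbb => /eqP ba; rewrite ba eqxx in nab.
Qed.

Lemma open_adj_edge w x y : open_adj w x y -> E x y.
Proof. by rewrite /open_adj; case: insubP => //= u + _ _; rewrite is_edge_pair. Qed.

Lemma open_adj_sym w : symmetric (open_adj w).
Proof. by move=> x y; rewrite /open_adj fsetUC. Qed.

Lemma open_adj_mono w w' : (forall i, w i -> w' i) ->
  forall x y, open_adj w x y -> open_adj w' x y.
Proof. by move=> ww' x y; rewrite /open_adj; case: insub => //= u; exact: ww'. Qed.

Lemma open_connection_increasing A x y :
  increasing_event (@open_connection d E A x y).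
Proof.
move=> w w' ww'; apply: (@joined_map _ _ _ _ _ id) => // u v _ _.
exact: open_adj_mono.
Qed.

Definition edges_of vs : seq (edge E) :=
  pmap insub [seq [fset x; y]%fset | x <- vs, y <- vs].

Lemma edges_of_depends A vs x y : A `<=` [set` vs] ->
  depends_on (edges_of vs) (@open_connection d E A x y).
Proof.
move=> Avs w w' ww'; apply: (@joined_map _ _ _ _ _ id) => // u v Au Av.
rewrite /open_adj; case: insubP => //= e _ eE; rewrite ww'//.
rewrite mem_pmap; apply/mapP; exists (val e); last by rewrite valK.
by rewrite [val e]eE; apply/allpairsP; exists (u, v); split=> //; exact: Avs.
Qed.

(** [edges_of] keeps edges with both ends in the list; an edge running from one list to the other
    belongs to neither. All independence between connections rests on this. *)
Lemma edges_of_disjoint vs vs' : {in vs, forall x, x \notin vs'} ->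
  {in edges_of vs, forall e, e \notin edges_of vs'}.
Proof.
move=> dis e; rewrite !mem_pmap => /mapP[_ /allpairsP[[x y] [/= xs ys ->]]].
case: insubP => //= e' _ eE [ee']; apply/negP.
move=> /mapP[_ /allpairsP[[x' y'] [/= xs' ys' ->]]].
case: insubP => //= e'' _ eE' [ee''].
have : x \in val e by rewrite ee' [val e']eE fset21.
rewrite ee'' [val e'']eE' in_fset2 => /orP[]/eqP xx; move: (dis x xs);
  by rewrite xx ?xs' ?ys'.
Qed.

Lemma finite_event_connection A x y : finite_set A ->
  finite_event (@open_connection d E A x y).
Proof.
move=> /finite_seqP[vs ->]; exists (edges_of vs); exact: edges_of_depends.
Qed.

Definition connect_pr (p : R) A x y : R := pr p (@open_connection d E A x y).

Section Connection.
Variable p : R.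
Hypothesis p01 : 0 <= p <= 1.

Lemma connect_pr_trans A x y z : finite_set A ->
  connect_pr p A x y * connect_pr p A y z <= connect_pr p A x z.
Proof.
move=> fA; have fe u v := @finite_event_connection A u v fA.
apply: le_trans (pr_harris p01 (fe x y) (fe y z) _ _) _;
  try exact: open_connection_increasing.
apply: le_pr; try by apply: finite_event_measurable => //; exact: finite_eventI.
by move=> w [xy yz]; exact: joined_trans yz.
Qed.

Lemma connect_pr_sub A B x y : finite_set B -> A `<=` B ->
  connect_pr p A x y <= connect_pr p B x y.
Proof.
move=> fB AB; have fA := sub_finite_set AB fB.
apply: le_pr; try by apply: finite_event_measurable; exact: finite_event_connection.
by move=> w; exact: joined_sub.
Qed.

Lemma connect_pr_sym A x y : connect_pr p A x y = connect_pr p A y x.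
Proof.
congr (pr p _); apply/seteqP; split=> w; apply: joined_sym; exact: open_adj_sym.
Qed.

Lemma connect_pr_path n A x y : finite_set A ->
  joined_le n E A x y -> p ^+ n <= connect_pr p A x y.
Proof.
move=> fA [s [es <- sA sn]].
pose es' : seq (edge E) := pmap insub (pairmap (fun a b => [fset a; b]%fset) x s).
have /andP[p0 p1] := p01.
apply: (@le_trans _ _ (p ^+ size es')).
  apply: ler_wiXn2l => //; rewrite size_pmap.
  by apply: leq_trans (count_size _ _) _; rewrite size_pairmap.
apply: le_trans (pr_all_open p01 es') _.
have m1 : finite_event [set w : config (edge E) | forall i, i \in es' -> w i].
  by exists es' => w v wv H i si; rewrite -wv ?H.
apply: le_pr; [exact: finite_event_measurable| |].
  apply: finite_event_measurable; exact: (finite_event_connection _ _ fA).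
move=> w /= H; exists s; split=> //.
elim: s x es {sA sn} @es' H {m1} => [//|u s IH] x /= /andP[xu us] H.
apply/andP; split.
  rewrite /open_adj; case: insubP => [e _ eE|]; last by rewrite is_edge_pair xu.
  by apply: H; rewrite -eE /= valK/= mem_head.
apply: IH => // i ies; apply: H; case: insubP => [e _ _|_] //=.
by rewrite inE ies orbT.
Qed.

Lemma connect_pr_refl A x : A x -> finite_set A -> connect_pr p A x x = 1.
Proof.
move=> Ax fA; apply/eqP; rewrite eq_le; apply/andP; split.
  by apply: pr_le1 => //; apply: finite_event_measurable; exact: finite_event_connection.
rewrite -(expr0 p); apply: connect_pr_path => //.
by exists [::]; split=> // v; rewrite inE => /eqP->.
Qed.

(** An automorphism [g] of the graph acts injectively on edges, and relabelling independent bits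
    preserves probabilities. The inverse [h] is there to write the image of [A] as a preimage. *)
Lemma connect_pr_map (g h : 'rV[int]_d -> 'rV[int]_d) A x y :
  cancel g h -> cancel h g -> (forall u v, E (g u) (g v) = E u v) ->
  finite_set A ->
  connect_pr p [set u | A (h u)] (g x) (g y) = connect_pr p A x y.
Proof.
move=> gh hg Eg fA.
have edge_im (e : edge E) : is_edge E (g @` val e)%fset.
  have /asboolP[a [b [ab ->]]] := valP e.
  by rewrite imfset_fset2 is_edge_pair Eg.
pose t (e : edge E) : edge E := Sub (g @` val e)%fset (edge_im e).
have tinj : injective t.
  move=> e e' /(congr1 val) /= ee'; apply/val_inj/fsetP => u.
  have M (a : edge E) := mem_imfset imfset_key (mem (val a)) (can_inj gh) u.
  by rewrite -(M e) -(M e') ee'.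
have tadj w u v : open_adj (fun i => w (t i)) u v = open_adj w (g u) (g v).
  rewrite /open_adj; case: insubP => /= [e eP eE|].
    have te : val (t e) = [fset g u; g v]%fset.
      by rewrite /t /= [val e]eE imfset_fset2.
    by rewrite -te valK.
  rewrite is_edge_pair -Eg => nE.
  by rewrite insubF// is_edge_pair; exact: negbTE.
rewrite /connect_pr -(pr_reindex p01 tinj (finite_event_connection x y fA)).
congr (pr p _); apply/seteqP; split=> w; rewrite /open_connection/=.
  move=> H; rewrite -(gh x) -(gh y); apply: joined_map H => // u v _ _ uv.
  by rewrite tadj !hg.
by apply: joined_map => [u v _ _|v]; rewrite ?tadj// /= gh.
Qed.

End Connection.

End OpenConnections.

(** * Boxes, periods and paths *)

Lemma sgz_mul_self (a : int) : sgz a * a = `|a|.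
Proof. by case: sgzP => [->|a0|a0]; rewrite ?mulr0 ?normr0 ?mul1r ?mulN1r; lia. Qed.

Lemma row_addE d (u v : 'rV[int]_d) i : (u + v) 0 i = u 0 i + v 0 i.
Proof. by rewrite mxE. Qed.

Lemma row_oppE d (u : 'rV[int]_d) i : (- u) 0 i = - u 0 i.
Proof. by rewrite mxE. Qed.

Lemma row_zeroE d (i : 'I_d) : (0 : 'rV[int]_d) 0 i = 0.
Proof. by rewrite mxE. Qed.

Definition rowE := (@row_addE, @row_oppE, @row_zeroE, @mxE).

(* Entries of the same matrix may carry convertible but distinct types, which
   [lia] would treat as different atoms. *)
Ltac mxlia :=
  repeat match goal with H : is_true ?P |- _ =>
    match P with context [fun_of_matrix] => move: H end end;
  repeat match goal with |- context [@fun_of_matrix ?T ?p ?n ?u ?a ?b] =>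
    move: (@fun_of_matrix T p n u a b) => ? end;
  lia.

(** Source of the uniform constants: periodicity reduces a question to finitely many positions, and
    this lemma takes a common bound over them. *)
Lemma finite_bound (T : choiceType) (A : set T) (P : T -> nat -> Prop) :
  finite_set A -> (forall x, A x -> exists n, P x n) ->
  (forall x n n', (n <= n')%N -> P x n -> P x n') ->
  exists n, forall x, A x -> P x n.
Proof.
move=> /finite_seqP[s ->] + mono; elim: s => [|x s IH] H; first by exists 0%N.
have [n Hn] := H x (mem_head _ _).
have [y ys|n' Hn'] := IH; first by apply: H; rewrite /= inE ys orbT.
exists (n + n')%N => y /=; rewrite inE => /predU1P[->|ys].
  by apply: mono Hn; rewrite leq_addr.
by apply: mono (Hn' y ys); rewrite leq_addl.
Qed.

Section Boxes.
Variable d : nat.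
Implicit Types (x y z u v w t : 'rV[int]_d).

Definition cbox x r : set 'rV[int]_d := [set u | box r (u - x)].

Lemma box_mono r r' : (r <= r')%N -> box r `<=` @box d r'.
Proof. by move=> rr' u bu i; have := bu i; lia. Qed.

Lemma box0 r : @box d r 0.
Proof. by move=> i; rewrite rowE; lia. Qed.

Lemma boxD r r' u v : box r u -> box r' v -> box (r + r') (u + v).
Proof. by move=> bu bv i; have := bu i; have := bv i; rewrite rowE; lia. Qed.

Lemma boxN r u : box r (- u) <-> box r u.
Proof. by split=> bu i; have := bu i; rewrite rowE; lia. Qed.

Lemma box_opp r u : box r u -> box r (- u).
Proof. by move/boxN. Qed.

Lemma cbox_refl x r : cbox x r x.
Proof. by rewrite /cbox/= subrr; exact: box0. Qed.

Lemma cbox0 r : cbox 0 r = box r.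
Proof. by apply/seteqP; split=> u; rewrite /cbox/= subr0. Qed.

Lemma cbox_trans x y z r r' : cbox x r y -> cbox y r' z -> cbox x (r + r') z.
Proof. by move=> xy yz; rewrite /cbox/= -[z](subrK y) -addrA addnC; exact: boxD. Qed.

Lemma cbox_sym x y r : cbox x r y -> cbox y r x.
Proof. by move=> /box_opp; rewrite opprB. Qed.

Lemma cbox_mono x r r' : (r <= r')%N -> cbox x r `<=` cbox x r'.
Proof. by move=> rr' u; exact: box_mono. Qed.

Definition box_seq r : seq 'rV[int]_d :=
  [seq map_mx (fun i : 'I_(r + r).+1 => i%:Z - r%:Z) v | v : 'rV['I_(r + r).+1]_d].

Lemma mem_box_seq r : box r = [set` box_seq r].
Proof.
apply/seteqP; split=> u /=.
  move=> bu; apply/fintype.imageP; exists (\row_i inord (absz (u 0 i + r%:Z))) => //.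
  apply/rowP => i; rewrite !rowE inordK; have := bu i; mxlia.
by move=> /fintype.imageP[v _ ->] i; rewrite rowE; have := ltn_ord (v 0 i); mxlia.
Qed.

Lemma size_box_seq r : size (box_seq r) = ((r + r).+1 ^ d)%N.
Proof. by rewrite size_image card_mx card_ord mul1n. Qed.

Lemma finite_box r : finite_set (@box d r).
Proof. by rewrite mem_box_seq; exact: finite_seq. Qed.

Definition cbox_seq x r : seq 'rV[int]_d := [seq u + x | u <- box_seq r].

Lemma mem_cbox_seq x r : cbox x r = [set` cbox_seq x r].
Proof.
apply/seteqP; split=> u; rewrite /cbox /cbox_seq /= mem_box_seq /=.
  by move=> bu; apply/mapP; exists (u - x); rewrite ?subrK.
by case/mapP => v bv ->; rewrite addrK.
Qed.

Lemma finite_cbox x r : finite_set (cbox x r).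
Proof. by rewrite mem_cbox_seq; exact: finite_seq. Qed.

Lemma finite_set_box (A : set 'rV[int]_d) : finite_set A -> exists r, A `<=` box r.
Proof.
move=> fA; have [||n Hn] := @finite_bound _ A (fun x r => box r x) fA.
- move=> x _; exists (\sum_i absz (x 0%R i))%N => i.
  by rewrite (bigD1 i)//=; lia.
- by move=> x r r' /box_mono; apply.
by exists n.
Qed.

Lemma reflectionK i : involutive (@reflection d i).
Proof. by move=> x; apply/rowP => j; rewrite !rowE; case: eqP => // _; rewrite opprK. Qed.

Lemma reflectionD i x y : reflection i (x + y) = reflection i x + reflection i y.
Proof. by apply/rowP => j; rewrite !rowE; case: eqP => // _; rewrite opprD. Qed.

Lemma box_reflection i r x : box r (reflection i x) <-> box r x.
Proof.
split=> bx j; have := bx j; rewrite ?rowE; case: eqP => // _; by rewrite normrN.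
Qed.

Lemma box_col_perm (s : 'S_d) r x : box r (col_perm s x) <-> box r x.
Proof.
split=> bx j; last by rewrite rowE; exact: bx.
by have := bx (s^-1%g j); rewrite rowE permKV.
Qed.

End Boxes.

(** * Periods of the graph *)

Section Period.
Variables (R : realType) (d : nat) (E : rel 'rV[int]_d).
Hypothesis symE : coordinate_symmetric E.
Implicit Types (x y z u v w t : 'rV[int]_d).

Definition translation t := forall x y, E (x + t) (y + t) = E x y.

Lemma translation0 : translation 0.
Proof. by move=> x y; rewrite !addr0. Qed.

Lemma translationD s t : translation s -> translation t -> translation (s + t).
Proof. by move=> Hs Ht x y; rewrite !addrA Ht Hs. Qed.

Lemma translationN t : translation t -> translation (- t).
Proof. by move=> Ht x y; rewrite -[LHS]Ht !subrK. Qed.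

Lemma translationMn t n : translation t -> translation (t *+ n).
Proof.
move=> Ht; elim: n => [|n IH]; first exact: translation0.
by rewrite mulrS; exact: translationD.
Qed.

Lemma translationMz t (k : int) : translation t -> translation (t *~ k).
Proof.
case: k => n Ht; first exact: translationMn.
by rewrite NegzE mulrNz; apply/translationN/translationMn.
Qed.

Lemma translation_reflection i t : translation t -> translation (reflection i t).
Proof.
move=> Ht x y; have [_ sE] := symE.
by rewrite -(sE i) !reflectionD !reflectionK Ht sE.
Qed.

Lemma translation_perm (s : 'S_d) t : translation t -> translation (col_perm s t).
Proof.
move=> Ht x y; have [sE _] := symE.
have K u : u + col_perm s t = col_perm s (col_perm s^-1%g u + t).
  by apply/rowP => j; rewrite !rowE permK.
by rewrite !K sE Ht sE.
Qed.

(** By spanning, some period [t0] has a nonzero coordinate [j]. Subtracting its reflection leaves a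
    multiple of the [j]-th unit vector by twice that coordinate, and permutations carry this period
    to all the axes. *)
Lemma exists_period (i0 : 'I_d) : lattice R E -> exists2 m : nat, (0 < m)%N &
  forall t, (forall i, (m%:Z %| t 0%R i)%Z) -> translation t.
Proof.
move=> [_ _ _ [L [L0 _ Lspan Ltrans]]].
have [t0 [Lt0 [j t0j]]] : exists t, L t /\ exists j, t 0 j != 0.
  apply: contrapT => H.
  have [n [a [t [Lt]]]] := Lspan (const_mx 1).
  move=> /rowP/(_ i0); rewrite rowE summxE big1 => [/eqP|i _].
    by rewrite oner_eq0.
  rewrite !rowE (_ : t i 0 i0 = 0) ?mulr0//.
  apply/eqP/negPn/negP => ti; apply: H; exists (t i); split=> //; by exists i0.
have Tt0 : translation t0 by move=> x y; exact: Ltrans.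
pose m := absz (t0 0 j *+ 2).
have m0 : (0 < m)%N by rewrite /m; lia.
exists m => // t Ht.
have Tdelta i : translation (m%:Z *: delta_mx 0 i).
  have T1 : translation ((t0 0 j *+ 2) *: delta_mx 0 j).
    rewrite (_ : _ *: _ = t0 - reflection j t0); last first.
      apply/rowP => k; rewrite !rowE eqxx /=.
      by have [->|_] := eqVneq k j; rewrite ?mulr1 ?mulr0 ?subrr// opprK mulr2n.
    by apply: translationD => //; apply/translationN/translation_reflection.
  have T2 : translation (m%:Z *: delta_mx 0 j).
    rewrite /m; have [ge0|lt0] := leP 0 (t0 0 j).
      by rewrite gez0_abs//; lia.
    rewrite (_ : _ *: _ = - ((t0 0 j *+ 2) *: delta_mx 0 j)).
      exact: translationN.
    by rewrite -scaleNr; congr (_ *: _); lia.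
  rewrite (_ : _ *: _ = col_perm (tperm i j) (m%:Z *: delta_mx 0 j)).
    exact: translation_perm.
  apply/rowP => k; rewrite !rowE/=; congr (_ * _%:R); congr nat_of_bool.
  by case: tpermP => [->|->|/eqP ki /eqP kj]; rewrite ?eqxx// (negbTE ki) (negbTE kj).
rewrite [t]row_sum_delta; elim/big_rec: _ => [|i u _ Tu]; first exact: translation0.
apply: translationD => //; have /dvdzP[q ->] := Ht i.
by rewrite -scalerA -[q]intz scaler_int; exact: translationMz.
Qed.

End Period.

(** * Paths of uniformly bounded length *)

Section Geometry.
Variables (d : nat) (E : rel 'rV[int]_d) (m : nat).
Hypotheses (m_gt0 : (0 < m)%N)
  (Hm : forall t : 'rV[int]_d, (forall i, (m%:Z %| t 0%R i)%Z) -> translation E t).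
Implicit Types (x y z u v w t : 'rV[int]_d).

Definition periodic t : Prop := forall i, (m%:Z %| t 0%R i)%Z.
Definition residue x := \row_i (x 0%R i %% m%:Z)%Z : 'rV[int]_d.

Lemma box_residue x : box m (residue x).
Proof.
move=> i; rewrite rowE.
have := modz_ge0 (x 0 i) (_ : m%:Z != 0); have := ltz_pmod (x 0 i) (_ : 0 < m%:Z).
by lia.
Qed.

Lemma periodic_residue x : periodic (x - residue x).
Proof.
move=> i; rewrite !rowE; apply/dvdzP; exists (x 0%R i %/ m%:Z)%Z.
by rewrite {1}(divz_eq (x 0 i) m) addrK.
Qed.

Lemma periodicD s t : periodic s -> periodic t -> periodic (s + t).
Proof. by move=> Hs Ht i; rewrite rowE rpredD. Qed.

Lemma periodicN t : periodic t -> periodic (- t).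
Proof. by move=> Ht i; rewrite rowE rpredN. Qed.

Lemma periodic0 : periodic 0.
Proof. by move=> i; rewrite rowE dvdz0. Qed.

Lemma joined_le_translate n (A : set 'rV[int]_d) x y t : periodic t ->
  joined_le n E A x y -> joined_le n E [set u | A (u - t)] (x + t) (y + t).
Proof.
move=> Ht; apply: (@joined_le_map _ n E E A _ (fun u => u + t)) => [u v _ _|v Av] /=.
  by rewrite (Hm Ht).
by rewrite addrK.
Qed.

Lemma exists_range : (forall x, finite_set [set y | E x y]) ->
  exists rho : nat, forall x y, E x y -> cbox x rho y.
Proof.
move=> fE; have [||rho H] := @finite_bound _ (@box d m)
    (fun x n => forall y, E x y -> cbox x n y) (@finite_box d m).
- move=> x _; have [n Hn] := finite_set_box (fE x).
  have [n' Hn'] := finite_set_box (@finite_set1 _ x).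
  exists (n + n')%N => y xy; apply: boxD; first exact: Hn.
  by apply: box_opp; exact: Hn'.
- by move=> x n n' nn' H y /H; exact: cbox_mono.
exists rho => x y xy; pose t := x - residue x.
have Ht : periodic t := periodic_residue x.
have := H (residue x) (box_residue x) (y - t).
rewrite -(Hm Ht) subrK /t addrC subrK => /(_ xy).
by rewrite /cbox /= opprB addrA addrAC addrK.
Qed.

Variable rho : nat.
Hypotheses (Hrho : forall x y, E x y -> cbox x rho y)
  (connE : connected_graph E) (Esym : symmetric E).

Lemma joined_le_near n (A : set 'rV[int]_d) x y :
  joined_le n E A x y -> joined_le n E (A `&` cbox x (rho * n)) x y.
Proof.
case=> s [es sy sA sn]; exists s; split=> // v vs; split; first exact: sA.
apply: (@cbox_mono _ _ (rho * size s)); first by rewrite leq_mul2l sn orbT.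
elim: s x v es {sA sy sn} vs => [|z s IH] x v /=.
  by move=> _; rewrite inE => /eqP->; exact: cbox_refl.
move=> /andP[xz zs]; rewrite inE => /predU1P[->|vs]; first exact: cbox_refl.
by rewrite mulnS; apply: cbox_trans (IH _ _ zs vs); exact: Hrho.
Qed.

(** Translating [x] to its residue leaves finitely many pairs, each joined by connectedness. *)
Lemma exists_uniform_path K : exists N, forall x y, cbox x K y ->
  joined_le N E setT x y.
Proof.
have [|||N H] := @finite_bound _ (@box d m `*` @box d (K + m))
    (fun xy n => joined_le n E setT xy.1 xy.2).
- by apply: finite_setX; exact: finite_box.
- by move=> [x y] _ /=; have [n _ ?] := joined_ex 0 (connE x y); exists n.
- by move=> xy n n' nn'; exact: joined_le_mono.
exists N => x y xy; pose t := x - residue x.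
have Ht : periodic t := periodic_residue x.
have Hb : (@box d m `*` @box d (K + m)) (residue x, y - t).
  split=> /=; first exact: box_residue.
  by rewrite /t opprB addrCA addrC; apply: boxD => //; exact: box_residue.
have := joined_le_translate Ht (H _ Hb).
by rewrite /= subrK /t addrC subrK; apply: joined_le_map.
Qed.

(** Intersection of half-spaces: a coordinate with [s] equal to 1 or -1 is constrained on that side,
    a coordinate with [s] equal to 0 is free. *)
Definition orthant (s : 'rV[int]_d) (r : nat) : set 'rV[int]_d :=
  [set v | forall i, s 0 i != 0 -> s 0 i * v 0 i <= r%:Z].

(** The vertex is asked to be periodic because moves are available only from periodic vertices. *)
Definition deep D (s : 'rV[int]_d) (r : nat) w :=
  periodic w /\ forall i, s 0 i != 0 -> s 0 i * w 0 i <= r%:Z - D%:Z.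

(** Up to translation by periods only the signs [s], the residue of [r] and a bounded position of
    [z] matter, which leaves finitely many cases. Some of them may admit no path, so the bound is
    conditional on the existence of one. *)
Lemma exists_orthant_path K D : exists N, forall s r z, box 1 s ->
  (forall i, s 0 i != 0 -> 0 <= r%:Z - s 0 i * z 0 i <= K%:Z) ->
  (exists2 w, deep D s r w & joined E (orthant s r) z w) ->
  exists2 w, deep D s r w & joined_le N E (orthant s r) z w.
Proof.
pose P (a : 'rV[int]_d * 'rV[int]_d * nat) n :=
  (exists2 w, deep D a.1.1 a.2 w & joined E (orthant a.1.1 a.2) a.1.2 w) ->
  exists2 w, deep D a.1.1 a.2 w & joined_le n E (orthant a.1.1 a.2) a.1.2 w.
have [|||N H] := @finite_bound _ ((@box d 1 `*` @box d (K + m)) `*` `I_m) P.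
- apply: finite_setX; last exact: finite_II.
  by apply: finite_setX; exact: finite_box.
- move=> a _; have [[w wd zw]|nw] := pselect (exists2 w, deep D a.1.1 a.2 w &
      joined E (orthant a.1.1 a.2) a.1.2 w).
    have [n _ zwn] := joined_ex 0 zw; exists n => _; by exists w.
  by exists 0%N => /nw.
- move=> a n n' nn' Pn /Pn[w wd zw]; exists w => //; exact: joined_le_mono zw.
exists N => s r z bs zK [w wd zw].
pose q := ((r %/ m) * m)%N; pose r0 := (r %% m)%N.
have rE : r = (q + r0)%N by exact: divn_eq.
(* In a constrained coordinate [t] brings the face from [r] to [r %% m]; in a free one it brings [z]
   to its residue. *)
pose t := \row_i (if s 0 i != 0 then s 0 i * q%:Z else (z - residue z) 0 i) : 'rV[int]_d.
have Ht : periodic t.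
  move=> i; rewrite rowE; case: ifP => _; last exact: periodic_residue.
  by apply: dvdz_mull; rewrite /q PoszM; apply: dvdz_mull.
have s1 i : s 0 i != 0 -> s 0 i = 1 \/ s 0 i = -1.
  by move=> si; have := bs i; mxlia.
have s2 i : s 0 i != 0 -> s 0 i * s 0 i = 1 by case/s1 => ->.
have st i v : s 0 i != 0 -> s 0 i * (v + t) 0 i = s 0 i * v 0 i + q%:Z.
  by move=> si; rewrite !rowE si mulrDr mulrA s2// mul1r.
have st' i v : s 0 i != 0 -> s 0 i * (v - t) 0 i = s 0 i * v 0 i - q%:Z.
  by move=> si; rewrite !rowE si mulrBr mulrA s2// mul1r.
have wd0 : deep D s r0 (w - t).
  have [pw ws] := wd; split; first by apply: periodicD => //; exact: periodicN.
  by move=> i si; rewrite st'//; have := ws i si; lia.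
have zw0 : joined E (orthant s r0) (z - t) (w - t).
  have [n _ /(joined_le_translate (periodicN Ht))/joined_leW] := joined_ex 0 zw.
  apply: joined_sub => v /= Hv i si; have := Hv i si.
  by rewrite opprK st//; lia.
have [||w' [pw' ws'] zw'] := H (s, z - t, r0) _ _.
- split=> /=; last by rewrite ltn_mod.
  split=> //= i; have [si|si] := eqVneq (s 0 i) 0.
    have := box_residue z i; rewrite !rowE si eqxx /=.
    by rewrite opprB addrC subrK; mxlia.
  have := zK i si; have := st' i z si; have := ltn_pmod r m_gt0; rewrite -/r0.
  by case: (s1 i si) => ->; rewrite ?mul1r ?mulN1r; mxlia.
- by exists (w - t).
exists (w' + t).
  split; first exact: periodicD.
  by move=> i si; rewrite st//; have := ws' i si; rewrite /=; lia.
have := joined_le_translate Ht zw'; rewrite subrK.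
rewrite -{2}[z]/(id z); apply: (@joined_le_map _ _ _ _ _ _ id) => // v /= Hv i si.
by have := Hv i si; rewrite st'//; lia.
Qed.

(* A path of E may have to run along the boundary of the box before it can
   leave it, so a vertex close to several faces is compared with the
   intersection of the corresponding half-spaces. By pigeonhole some scale
   separates the distances from z to the faces: near faces are kept, and the
   bounded path found in the orthant is too short to reach the others. *)
Lemma exists_inward_path D : exists N R0, forall r z, (R0 <= r)%N ->
  joined E (box r) 0 z ->
  exists2 w, periodic w /\ box (r - D) w & joined_le N E (box r) z w.
Proof.
have [Nf HNf] := choice (fun K => exists_orthant_path K D).
(* Each threshold exceeds the previous one by more than the reach of the path found for the previous
   one, plus the depth [D]. *)
pose Kf := fix Kf j := if j is j'.+1 then
  (Kf j' + rho * Nf (Kf j') + D).+1 else 0%N.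
have KfS j : Kf j.+1 = (Kf j + rho * Nf (Kf j) + D).+1 by [].
have Kf_mono i j : (i <= j)%N -> (Kf i <= Kf j)%N.
  move=> /subnKC <-; elim: (j - i)%N => [|k IH]; first by rewrite addn0.
  by rewrite addnS KfS; lia.
pose N := (\sum_(j < d.+1) Nf (Kf j))%N.
exists N, (Kf d.+1 + D).+1 => r z rR z0.
have bz := joined_endr z0.
(* There are [d.+1] disjoint windows between consecutive thresholds and only [d] distances, so one
   window is empty. *)
have [j Hj] : exists j : 'I_d.+1, forall i : 'I_d,
    (r%:Z - `|z 0 i| <= (Kf j)%:Z) \/ ((Kf j.+1)%:Z < r%:Z - `|z 0 i|).
  apply: contrapT => nj.
  have Hf (j : 'I_d.+1) : exists i : 'I_d,
      (Kf j)%:Z < r%:Z - `|z 0 i| <= (Kf j.+1)%:Z.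
    apply: contrapT => ni; apply: nj; exists j => i; apply: contrapT => nor.
    by apply: ni; exists i; lia.
  have [f {}Hf] := choice Hf.
  have finj : injective f.
    move=> j j' jj'; apply/val_inj; have := Hf j; have := Hf j'; rewrite -jj'.
    have [jj|jj|//] := ltngtP (j : nat) j'.
      by have := Kf_mono _ _ jj; mxlia.
    by have := Kf_mono _ _ jj; mxlia.
  by have := leq_card f finj; rewrite !card_ord ltnn.
have NfN : (Nf (Kf j) <= N)%N by rewrite /N (bigD1 j)//= leq_addr.
have Kd : (Kf j.+1 <= Kf d.+1)%N by apply: Kf_mono; have := ltn_ord j; mxlia.
pose near i := r%:Z - `|z 0 i| <= (Kf j)%:Z.
pose s := \row_i (if near i then sgz (z 0 i) else 0) : 'rV[int]_d.
have sz i : s 0 i != 0 -> near i /\ s 0 i * z 0 i = `|z 0 i|.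
  by rewrite rowE; case: ifP => // ni; rewrite sgz_mul_self.
have snear i : near i -> s 0 i != 0.
  by move=> ni; rewrite rowE ni sgz_eq0; move: ni; rewrite /near; have := KfS j; mxlia.
have s1 i : s 0 i != 0 -> s 0 i = 1 \/ s 0 i = -1.
  by rewrite rowE; case: ifP => // _; case: sgzP => //; [left|right].
have bs : box 1 s.
  move=> i; have [->|/s1[]->] := eqVneq (s 0 i) 0; mxlia.
have sub : box r `<=` orthant s r.
  by move=> v bv i /s1[]->; have := bv i; mxlia.
have [||w [pw ws] zw] := HNf (Kf j) s r z bs.
- by move=> i /sz[ni ->]; have := bz i; move: ni; rewrite /near; mxlia.
(* The origin is deep, and the given path from 0 to [z], reversed, provides the path required in the
   orthant. *)
- exists 0; last by apply: joined_sub sub _; exact: joined_sym.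
  by split; [exact: periodic0|move=> i _; rewrite rowE; have := KfS j; mxlia].
have /joined_le_near {}zw := zw; set M := (rho * Nf (Kf j))%N in zw.
have KE : Kf j.+1 = (Kf j + M + D).+1 by [].
(* In a near coordinate the orthant handles the close face and the opposite one is out of reach; in
   the other coordinates both faces are farther than [Kf j.+1], hence than [M]. *)
have clamp v : orthant s r v -> cbox z M v -> box r v.
  move=> ov cv i; have := cv i; rewrite !rowE => cvi; have := bz i => bzi.
  have [ni|nni] := boolP (near i).
    have si := snear i ni; have := ov i si; have [_] := sz i si.
    by move: ni; rewrite /near; have [->|->] := s1 i si; mxlia.
  by have [|] := Hj i; move: nni; rewrite /near; mxlia.
exists w; last first.
  apply: joined_le_mono NfN _.
  by apply: (@joined_le_map _ _ _ _ _ _ id _ _ _ _ zw) => // v [ov cv]; exact: clamp.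
split=> // i; have [_ cw] := joined_endr (joined_leW zw).
have := cw i; rewrite !rowE => cwi; have bzi := bz i.
have [ni|nni] := boolP (near i).
  have si := snear i ni; have := ws i si; have [_] := sz i si.
  by move: ni; rewrite /near; have [->|->] := s1 i si; mxlia.
by have [|] := Hj i; move: nni; rewrite /near; mxlia.
Qed.

End Geometry.

(** * Crossings of boxes at criticality *)

Lemma sumr_le_size (R : realType) (T : eqType) (l : seq T) (F : T -> R) c :
  (forall i, i \in l -> F i <= c) -> \sum_(i <- l) F i <= (size l)%:R * c.
Proof.
move=> H; rewrite big_seq; apply: (le_trans (ler_sum _ H)).
by rewrite -big_seq big_const_seq count_predT iter_addr_0 mulr_natl.
Qed.

Section Critical.
Variables (R : realType) (d : nat) (E : rel 'rV[int]_d) (m rho : nat).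
Hypotheses (m_gt0 : (0 < m)%N)
  (Hm : forall t : 'rV[int]_d, periodic m t -> translation E t)
  (Hrho : forall x y, E x y -> cbox x rho y)
  (connE : connected_graph E) (Esym : symmetric E) (Eirr : irreflexive E).
Implicit Types (x y z u v t : 'rV[int]_d) (p : R) (w : config (edge E)).

(** Possible landing points of a path that leaves [cbox x N], its steps being bounded by [rho]. They
    turn the one-arm event into one depending on finitely many edges. *)
Definition far_seq x N := [seq y <- cbox_seq x (N + rho) | ~~ `[< cbox x N y >]].

Definition far_event N x : set (config (edge E)) :=
  [set w | exists2 y, y \in far_seq x N & @open_connection d E (cbox x (N + rho)) x y w].

Lemma finite_event_far N x : finite_event (far_event N x).
Proof.
apply: finite_event_bigcup => y _; apply: finite_event_connection.
exact: finite_cbox.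
Qed.

Lemma mem_far_seq x N y : cbox x (N + rho) y -> ~ cbox x N y -> y \in far_seq x N.
Proof.
move=> xy nxy; rewrite mem_filter; apply/andP; split; first exact/asboolPn.
by move: xy; rewrite mem_cbox_seq.
Qed.

Lemma exit_far w (A : set 'rV[int]_d) x y N :
  joined (open_adj w) A x y -> ~ cbox x N y ->
  exists2 z, z \in far_seq x N & joined (open_adj w) (A `&` cbox x (N + rho)) x z.
Proof.
move=> xy nxy; have [u [v [xu uv nv Av]]] := first_exit (@cbox_refl _ x N) nxy xy.
have [xNu Au] := joined_endr xu.
have xv : cbox x (N + rho) v.
  by apply: cbox_trans xNu _; apply: Hrho; exact: open_adj_edge uv.
exists v; first exact: mem_far_seq.
apply: (@joined_trans _ _ _ _ u); last first.
  by apply: joined_edge => //; split=> //; apply: cbox_mono xNu; rewrite leq_addr.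
by apply: joined_sub xu => a [xa Aa]; split=> //; apply: cbox_mono xa; rewrite leq_addr.
Qed.

Lemma connect_pr_translate p (n : nat) t x y : 0 <= p <= 1 -> periodic m t ->
  connect_pr E p (cbox t n) (x + t) (y + t) = connect_pr E p (box n) x y.
Proof.
move=> p01 Ht; apply: (connect_pr_map Esym Eirr p01 (g := fun u => u + t)
    (h := fun u => u - t) (A := box n)).
- by move=> u; rewrite addrK.
- by move=> u; rewrite subrK.
- exact: Hm.
- exact: finite_box.
Qed.

(** An arm from [x] splits into a crossing of a box [A] up to its first exit at [u], and an arm
    outside [A] from the vertex [v] that follows the last visit. The first piece uses edges inside
    [A], the second edges outside, so plain independence suffices; the prefactor counts the pairs
    (u, v). *)
Lemma far_le_expr p n (eps : R) : 0 <= p <= 1 -> (m <= n)%N ->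
  0 <= eps -> (forall x u, box m x -> box_boundary E n u ->
    connect_pr E p (box n) x u <= eps) ->
  forall k x, pr p (far_event (k * (m + n + rho)) x) <=
    ((size (box_seq d n) * size (box_seq d (n + rho)))%:R * eps) ^+ k.
Proof.
move=> p01 mn eps0 Heps; set s := (m + n + rho)%N.
set lam := _%:R * _; elim=> [|k IH] x.
  rewrite expr0; apply: pr_le1 => //.
  by apply: finite_event_measurable; exact: finite_event_far.
(* The hypothesis on crossings transfers only to boxes centred at periods, so the box is centred at
   [t], within [m] of [x]. *)
pose t := x - residue m x; pose A := cbox t n.
have Ht : periodic m t := periodic_residue m x.
have tx : cbox t m x by rewrite /cbox/= /t opprB addrC subrK; exact: box_residue.
have Ax : A x by exact: cbox_mono tx.
pose us := [seq u <- cbox_seq t n | `[< box_boundary E n (u - t) >]].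
pose vs := cbox_seq t (n + rho).
pose G v : set (config (edge E)) := [set w | exists2 y, y \in far_seq v (k * s) &
  @open_connection d E (~` A `&` cbox v (k * s + rho)) v y w].
have fG v : finite_event (G v).
  apply: finite_event_bigcup => y _; apply: finite_event_connection.
  by apply: sub_finite_set (@finite_cbox _ v (k * s + rho)) => a [].
have fA u : finite_event (@open_connection d E A x u).
  by apply: finite_event_connection; exact: finite_cbox.
pose B (uv : 'rV[int]_d * 'rV[int]_d) := @open_connection d E A x uv.1 `&` G uv.2.
apply: (@le_trans _ _ (\sum_(uv <- [seq (u, v) | u <- us, v <- vs]) pr p (B uv))).
  apply: pr_union => //.
  - by apply: finite_event_measurable; exact: finite_event_far.
  - by move=> uv _; exact: finite_eventI.
  move=> w [y yfar xy].
  have nxy : ~ cbox x (k.+1 * s) y.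
    by move: yfar; rewrite mem_filter => /andP[/asboolPn].
  have nAy : ~ A y.
    move=> Ay; apply: nxy; apply: (@cbox_mono _ _ (m + n)).
      by rewrite /s mulSn; lia.
    by apply: cbox_trans Ay; exact: cbox_sym.
  have [u [v0 [xu uv0 nAv0 _]]] := first_exit Ax nAy xy.
  have [u' [v [Au' u'v vy]]] := last_exit (@open_adj_sym _ _ w) Ax nAy xy.
  have tv : cbox t (n + rho) v.
    by apply: cbox_trans Au' _; apply: Hrho; exact: open_adj_edge u'v.
  (* Since [v] lies within m + n + rho of [x], only one scale has been used up. *)
  have nvy : ~ cbox v (k * s) y.
    move=> vy'; apply: nxy; apply: (@cbox_mono _ _ (m + (n + rho) + k * s)).
      by rewrite /s mulSn; lia.
    by apply: cbox_trans vy'; apply: cbox_trans tv; exact: cbox_sym.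
  have [z zfar vz] := exit_far vy nvy.
  exists (u, v).
    apply/allpairsP; exists (u, v); split=> //=.
      rewrite mem_filter; apply/andP; split; last first.
        by have [Au _] := joined_endr xu; move: Au; rewrite /A mem_cbox_seq.
      apply/asboolP; split; first by have [] := joined_endr xu.
      exists (v0 - t); split; first exact: nAv0.
      rewrite (Hm (periodicN Ht)); exact: open_adj_edge uv0.
    by move: tv; rewrite mem_cbox_seq.
  split=> /=; first by apply: joined_sub xu => a [].
  by exists z => //; apply: joined_sub vz => a [[nAa _] va].
have pB uv : uv \in [seq (u, v) | u <- us, v <- vs] -> pr p (B uv) <= eps * lam ^+ k.
  case/allpairsP => [[u v] [/= uus _ ->]].
  pose out := [seq a <- cbox_seq v (k * s + rho) | ~~ `[< A a >]].
  have dA : depends_on (edges_of E (cbox_seq t n)) (@open_connection d E A x u).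
    by apply: edges_of_depends; rewrite /A mem_cbox_seq.
  have dG : depends_on (edges_of E out) (G v).
    move=> w w' ww' [y yf vy]; exists y => //.
    move: ww' vy; apply: edges_of_depends => a [/= nAa va].
    by rewrite mem_filter; apply/andP; split; [exact/asboolPn|move: va; rewrite mem_cbox_seq].
  rewrite /B/= (pr_indep p01 dA dG); last first.
    apply: edges_of_disjoint => a ta; rewrite mem_filter negb_and negbK.
    by apply/orP; left; apply/asboolP; rewrite /A mem_cbox_seq.
  apply: ler_pM; try exact: pr_ge0.
    move: uus; rewrite mem_filter => /andP[/asboolP bu _].
    have := Heps (residue m x) (u - t) (box_residue m_gt0 x) bu.
    have := @connect_pr_translate p n t (residue m x) (u - t) p01 Ht.
    by rewrite subrK {2}/t addrC subrK => <-.
  apply: le_trans (IH v); apply: le_pr; first exact: finite_event_measurable.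
    exact: finite_event_measurable (finite_event_far _ _).
  by move=> w [y yf vy]; exists y => //; apply: joined_sub vy => a [].
have size_uv : (size [seq (u, v) | u <- us, v <- vs] <=
    size (box_seq d n) * size (box_seq d (n + rho)))%N.
  rewrite size_allpairs leq_mul//; last by rewrite size_map.
  by rewrite size_filter; apply: leq_trans (count_size _ _) _; rewrite size_map.
have lam0 : 0 <= lam ^+ k by rewrite exprn_ge0 ?mulr_ge0.
apply: le_trans (sumr_le_size pB) _.
rewrite exprS mulrA; apply: ler_wpM2r => //.
by apply: ler_wpM2r => //; rewrite ler_nat.
Qed.

(** Boxes being finite, a component is infinite exactly when it reaches every scale. This writes
    percolation as a countable combination of finite events. *)
Lemma infinite_far s : (0 < s)%N -> infinite_open_component (E := E) =
  \bigcup_x \bigcap_k far_event (k * s) x.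
Proof.
move=> s0; apply/seteqP; split=> w.
  case=> x infx; exists x => // k _.
  have [y [xy nxy]] : exists y, open_component w x y /\ ~ cbox x (k * s) y.
    apply: contrapT => H; apply: infx.
    apply: sub_finite_set (@finite_cbox _ x (k * s)) => y xy.
    by apply: contrapT => nxy; apply: H; exists y.
  have [z zfar xz] := exit_far xy nxy; exists z => //.
  by apply: joined_sub xz => a [].
case=> x _ H; exists x => fx.
have [k Hk] := finite_set_box fx.
have [k' Hk'] := finite_set_box (finite_set1 x).
have [y] := H (k + k')%N I; rewrite mem_filter => /andP[/asboolPn nxy _] xy.
apply: nxy; apply: (@cbox_mono _ _ (k + k')); first by rewrite leq_pmulr.
apply: boxD; first by apply: Hk; exact: joined_sub xy.
by apply: box_opp; exact: Hk'.
Qed.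

Lemma measurable_infinite : measurable (infinite_open_component (E := E)).
Proof.
rewrite (@infinite_far 1)//; apply: countable_bigcupT_measurable => // x.
apply: bigcapT_measurable => k; apply: finite_event_measurable.
exact: finite_event_far.
Qed.

Lemma infinite_pr0 p s : 0 <= p <= 1 -> (0 < s)%N ->
  (forall k x, pr p (far_event (k * s) x) <= 2^-1 ^+ k) ->
  percolation E p (infinite_open_component (E := E)) = 0%E.
Proof.
move=> p01 s0 H; rewrite (infinite_far s0).
pose F x := \bigcap_k far_event (k * s) x.
have mF x : measurable (F x).
  apply: bigcapT_measurable => k.
  exact: finite_event_measurable (finite_event_far _ _).
have F0 x : percolation E p (F x) = 0%E.
  rewrite /percolation prE//; congr _%:E; apply/eqP; rewrite eq_le pr_ge0 andbT.
  apply/ler_addgt0Pr => e e0; rewrite add0r.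
  have Fk k : pr p (F x) <= 2^-1 ^+ k.
    apply: le_trans (H k x); apply: le_pr => //; last by move=> w /(_ k I).
    exact: finite_event_measurable (finite_event_far _ _).
  have /cvgrPdist_lt/(_ _ e0) : (fun k => (2^-1 : R) ^+ k) @ \oo --> (0 : R).
    by apply: cvg_expr; rewrite ger0_norm ?invr_ge0// invf_lt1 ?ltr1n.
  case=> k _ /(_ k (leqnn k)); rewrite sub0r normrN ger0_norm ?exprn_ge0 ?invr_ge0//.
  by move=> /ltW; exact: le_trans.
have : (percolation E p).-negligible (\bigcup_n
    if choice.unpickle n is Some x then F x else set0).
  apply: negligible_bigcup => n; case: choice.unpickle => [x|]; last exact: negligible_set0.
  by apply/negligibleP => //; exact: F0.
have -> : \bigcup_n (if choice.unpickle n is Some x then F x else set0) = \bigcup_x F x.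
  apply/seteqP; split=> w.
    by case=> n _; case: choice.unpickle => [x Fx|//]; exists x.
  by case=> x _ Fx; exists (choice.pickle x) => //; rewrite choice.pickleK.
move=> /negligibleP; apply.
by apply: countable_bigcupT_measurable.
Qed.

(** Value of [eps] for which the quantity raised to the power [k] in [far_le_expr] is 1/2. *)
Definition crit_eps n : R :=
  ((size (box_seq d n) * size (box_seq d (n + rho))).*2%:R)^-1.

Lemma infinite_lower_bound p n : 0 <= p <= 1 -> (m <= n)%N ->
  (0 < percolation E p (infinite_open_component (E := E)))%E ->
  exists x u, [/\ box m x, box_boundary E n u &
    crit_eps n < connect_pr E p (box n) x u].
Proof.
move=> p01 mn pinf; apply: contrapT => H.
have H' x u : box m x -> box_boundary E n u -> connect_pr E p (box n) x u <= crit_eps n.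
  by move=> bx bu; rewrite leNgt; apply/negP => lt; apply: H; exists x, u.
move: pinf; rewrite (@infinite_pr0 p (m + n + rho))// ?ltxx//; first by lia.
move=> k x; have := far_le_expr p01 mn _ H' k x.
rewrite (_ : _%:R * crit_eps n = 2^-1); first by apply; rewrite invr_ge0.
rewrite /crit_eps; set N := (_ * _)%N.
rewrite -muln2 natrM invfM mulrA mulfV ?mul1r//.
by rewrite pnatr_eq0 muln_eq0 negb_or -!lt0n !size_box_seq !expn_gt0.
Qed.

(** Makes the set whose infimum is [p_c] nonempty: at p = 1 almost surely no edge is closed, and by
    connectedness the component of 0 contains every vertex. *)
Lemma infinite_p1 (i0 : 'I_d) :
  (0 < percolation E (1 : R) (infinite_open_component (E := E)))%E.
Proof.
have p01 : 0 <= (1 : R) <= 1 by rewrite ler01 lexx.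
pose A : set (config (edge E)) := \bigcup_n
  (if choice.unpickle n is Some e then [set w : config (edge E) | w e = false] else set0).
have NA : (percolation E (1 : R) : probability _ R).-negligible A.
  apply: negligible_bigcup => n; case: choice.unpickle => [e|]; last exact: negligible_set0.
  apply/negligibleP; first exact: measurable_coordinate.
  have := @cylinder_prob R _ 1 _ (@bernoulli_productP R (edge E) 1 p01) [:: e] (fun=> false) isT.
  rewrite big_seq1 /= subrr => h; apply: etrans h; congr (percolation E (1 : R) _).
  apply/seteqP; split=> w /=; first by move=> we i; rewrite inE => /eqP->.
  by apply; rewrite mem_head.
have mA : measurable A.
  apply: bigcupT_measurable => n; case: choice.unpickle => // e; exact: measurable_coordinate.
have A0 : percolation E (1 : R) A = 0%E by apply/negligibleP.
have nA : ~` A `<=` infinite_open_component (E := E).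
  move=> w nAw; exists 0 => fin0; have [k Hk] := finite_set_box fin0.
  have /Hk/(_ i0) : open_component w 0 (const_mx k.+1%:Z).
    apply: (@joined_map _ E (open_adj w) setT setT id 0 _ _ _ (connE _ _)) => // u v _ _ uv.
    rewrite /open_adj; case: insubP => [e _ _ /=|]; last by rewrite is_edge_pair ?uv.
    by apply/negPn/negP => /negbTE we; apply: nAw; exists (choice.pickle e); rewrite ?choice.pickleK.
  by rewrite mxE; lia.
have AC : percolation E (1 : R) (~` A) = 1%E.
  apply: (etrans (probability_setC (percolation E (1 : R)) mA)).
  by transitivity (1 - (0 : \bar R))%E; [congr (_ - _)%E; exact: A0|exact: sube0].
apply: (@lt_le_trans _ _ (percolation E (1 : R) (~` A))); first by rewrite AC lte01.
apply: le_measure; rewrite ?inE//; first exact: measurableC.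
exact: measurable_infinite.
Qed.

Lemma p_c_infimum (i0 : 'I_d) :
  0 <= p_c R E <= 1 /\ forall e, 0 < e -> exists p, [/\ 0 <= p <= 1,
    (0 < percolation E p (infinite_open_component (E := E)))%E &
    `|p_c R E - p| < e].
Proof.
pose S : set R := [set p | 0 <= p <= 1 /\
  (0 < percolation E p (infinite_open_component (E := E)))%E].
have S1 : S 1 by split; [rewrite ler01 lexx|exact: infinite_p1].
have lbS : lbound S 0 by move=> p [/andP[]].
have iS : has_inf S by split; [exists 1|exists 0].
have lec p : S p -> p_c R E <= p by move=> Sp; apply: ge_inf => //; exists 0.
split.
  by apply/andP; split; [apply: lb_le_inf => //; exists 1|exact: lec].
move=> e e0; have [p Sp pe] := inf_adherent e0 iS.
exists p; have [p01 pinf] := Sp; split=> //.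
by rewrite distrC ger0_norm ?subr_ge0 ?lec// ltrBlDl.
Qed.

(** At every percolating p some pair exceeds [crit_eps n], but the pair depends on p. The sum over
    all pairs is continuous and exceeds this value at parameters arbitrarily close to p_c, so it is
    at least [crit_eps n] there; some pair then carries its share, the doubling making the
    inequality strict. *)
Lemma critical_lower_bound (i0 : 'I_d) n : (m <= n)%N ->
  exists x u, [/\ box m x, box_boundary E n u &
    crit_eps n / (size (box_seq d m) * size (box_seq d n)).*2%:R <
      connect_pr E (p_c R E) (box n) x u].
Proof.
move=> mn; have [pc01 pcinf] := p_c_infimum i0.
pose us := [seq u <- box_seq d n | `[< box_boundary E n u >]].
pose xus := [seq (x, u) | x <- box_seq d m, u <- us].
have [g gc Hg] : exists2 g : R -> R, continuous g & forall p, 0 <= p <= 1 ->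
    \sum_(xu <- xus) connect_pr E p (box n) xu.1 xu.2 = g p.
  elim: xus => [|xu l [g gc Hg]].
    exists (fun=> 0); first exact: cst_continuous.
    by move=> p _; rewrite big_nil.
  have [h hc Hh] := continuous_pr R (finite_event_connection E xu.1 xu.2 (@finite_box d n)).
  exists (fun p => h p + g p).
    by move=> p; apply: cvgD; [exact: hc|exact: gc].
  by move=> p p01; rewrite big_cons -Hg// -Hh.
have eps0 : 0 < crit_eps n.
  by rewrite invr_gt0 ltr0n double_gt0 muln_gt0 !size_box_seq !expn_gt0.
have gpc : crit_eps n <= g (p_c R E).
  rewrite leNgt; apply/negP => lt.
  have /cvgrPdist_lt/(_ (crit_eps n - g (p_c R E))) := gc (p_c R E).
  rewrite subr_gt0 => /(_ lt) /nbhs_ballP[e /= e0 He].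
  have [p [p01 pinf pe]] := pcinf e e0.
  have [x [u [bx bu xu]]] := infinite_lower_bound p01 mn pinf.
  have gp : crit_eps n < g p.
    apply: lt_le_trans xu _; rewrite -Hg//.
    have xuin : (x, u) \in xus.
      apply/allpairsP; exists (x, u); split=> //=.
        by move: bx; rewrite mem_box_seq.
      rewrite mem_filter; apply/andP; split; first exact/asboolP.
      by have [] := bu; rewrite mem_box_seq.
    rewrite (big_rem _ xuin)/= lerDl; apply: sumr_ge0 => *; exact: pr_ge0.
  have := He p pe; rewrite distrC => /(le_lt_trans (ler_norm _)).
  by rewrite ltrD2r => /(lt_trans gp); rewrite ltxx.
apply: contrapT => H; move: gpc; rewrite -Hg//; apply/negP; rewrite -ltNge.
set a := crit_eps n / _ in H.
have Hxu xu : xu \in xus -> connect_pr E (p_c R E) (box n) xu.1 xu.2 <= a.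
  case/allpairsP => [[x u] [/= bx + ->]]; rewrite mem_filter => /andP[/asboolP bu _] /=.
  rewrite leNgt; apply/negP => lt; apply: H; exists x, u; split=> //.
  by rewrite mem_box_seq.
apply: le_lt_trans (sumr_le_size Hxu) _.
have sxu : (size xus <= size (box_seq d m) * size (box_seq d n))%N.
  rewrite size_allpairs leq_mul//.
  by rewrite size_filter; exact: count_size.
have sz0 : (0 < size (box_seq d m) * size (box_seq d n))%N.
  by rewrite muln_gt0 !size_box_seq !expn_gt0.
rewrite /a mulrCA -[ltRHS]mulr1 ltr_pM2l// -muln2 natrM invfM mulrA.
apply: (@le_lt_trans _ _ (2^-1)); last by lra.
rewrite ler_piMl ?invr_ge0// ler_pdivrMr ?ltr0n// mul1r ler_nat//.
Qed.

(** At p = 0 distinct vertices are almost surely not joined, contradicting the crossing bound.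
    Taking n = m + rho keeps the boundary of Q_n off Q_m, so the two ends of the crossing are
    distinct. *)
Lemma p_c_gt0 (i0 : 'I_d) : 0 < p_c R E.
Proof.
have [pc01 _] := p_c_infimum i0; have /andP[pc0 _] := pc01.
rewrite lt_neqAle pc0 andbT; apply/eqP => pcE.
have mn : (m <= m + rho)%N by rewrite leq_addr.
have [x [u [bx [bu [v [nbv uv]]] lt]]] := critical_lower_bound i0 mn.
have xu : x != u.
  apply/eqP => xu; apply: nbv; rewrite -(subrK u v) addrC; apply: boxD; first by rewrite -xu.
  exact: Hrho.
move: lt; apply/negP; rewrite -leNgt.
apply: (@le_trans _ _ 0); last by rewrite divr_ge0// invr_ge0.
pose s := edges_of E (box_seq d (m + rho)).
have := pr_some_open pc01 s; rewrite -{2}pcE subr0 expr1n subrr; apply: le_trans.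
have ds : depends_on s (@open_connection d E (box (m + rho)) x u).
  by apply: edges_of_depends; rewrite mem_box_seq.
apply: le_pr; [apply: finite_event_measurable; by exists s| |].
  apply: finite_event_measurable; exists s => w w' ww' H H'; apply: H => i si.
  by rewrite ww'// H'.
move=> w xuw allc.
have : (@open_connection d E (box (m + rho)) x u) (fun=> false).
  by apply: (ds w) xuw => i /allc/negbTE.
case=> [[|z l] [/= + lu _]]; first by move=> _; rewrite lu eqxx in xu.
by rewrite /open_adj; case: insub.
Qed.

End Critical.

(** * Moves along an axis *)

Section Moves.
Variables (R : realType) (d : nat) (E : rel 'rV[int]_d) (m rho : nat) (i0 : 'I_d).
Hypotheses (m_gt0 : (0 < m)%N)
  (Hm : forall t : 'rV[int]_d, periodic m t -> translation E t)
  (Hrho : forall x y, E x y -> cbox x rho y)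
  (connE : connected_graph E) (Esym : symmetric E) (Eirr : irreflexive E)
  (symE : coordinate_symmetric E).
Implicit Types (x y z u v w t : 'rV[int]_d).

Local Notation pc := (p_c R E).
Local Notation conn := (connect_pr E pc).

Let pc01 : 0 <= pc <= 1.
Proof. by have [] := p_c_infimum R m_gt0 Hrho connE Esym Eirr i0. Qed.

Let pc_gt0 : 0 < pc.
Proof. exact: (p_c_gt0 R m_gt0 Hm Hrho connE Esym Eirr i0). Qed.

(** Completes each gluing at constant cost, using p_c > 0. *)
Lemma exists_local_connection K : exists N (c : R), [/\ 0 < c, c <= 1 &
  forall (A : set 'rV[int]_d) x y, finite_set A -> cbox x K y ->
    cbox x N `<=` A -> c <= conn A x y].
Proof.
have [N HN] := exists_uniform_path m_gt0 Hm connE K.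
have /andP[pc0 pc1] := pc01.
exists (rho * N)%N, (pc ^+ N); split; [exact: exprn_gt0|exact: exprn_ile1|].
move=> A x y fA xy sub; apply: (connect_pr_path Esym Eirr pc01) => //.
have := joined_le_near Hrho (HN _ _ xy).
by apply: (@joined_le_map _ _ _ _ _ _ id) => // v [_]; exact: sub.
Qed.

Lemma size_box_seq_le (n k : nat) : (0 < n)%N -> (k <= n.*2)%N ->
  (size (box_seq d k) <= (5 * n) ^ d)%N.
Proof.
move=> n0 kn; rewrite size_box_seq.
by case: (posnP d) => [->//|d0]; rewrite leq_exp2r//; lia.
Qed.

Lemma exists_seed : exists (a : R) (b n0 : nat), [/\ 0 < a, a <= 1 &
  forall n, (n0 <= n)%N -> exists2 u, box_boundary E n u &
    a / n%:R ^+ b <= conn (box n) 0 u].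
Proof.
have [N [c [c0 c1 Hc]]] := exists_local_connection m.
(* The lower bound at p_c involves two doublings and four box cardinals; a box of radius at most 2n
   has at most (5n)^d vertices. *)
pose a : R := c / (4 * 5 ^ (4 * d))%:R.
have D0 : (0 < 4 * 5 ^ (4 * d))%N by rewrite muln_gt0 expn_gt0.
exists a, (4 * d)%N, (m + rho + N + 1)%N; split.
- by rewrite divr_gt0// ltr0n.
- by rewrite ler_pdivrMr ?ltr0n// mul1r; apply: le_trans c1 _; rewrite ler1n.
move=> n nn0; have n0 : (0 < n)%N by lia.
have mn : (m <= n)%N by lia.
have [x [u [bx bu xu]]] := critical_lower_bound R m_gt0 Hm Hrho connE Esym Eirr i0 mn.
exists u => //; apply: le_trans (connect_pr_trans E pc01 0 x u (@finite_box d n)).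
rewrite /a -mulrA; apply: ler_pM.
- exact: ltW.
- by rewrite mulr_ge0// invr_ge0// exprn_ge0.
- apply: Hc; [exact: finite_box|by rewrite cbox0|].
  by rewrite cbox0; apply: box_mono; lia.
apply: le_trans (ltW xu); rewrite /crit_eps -!invfM lef_pV2 ?posrE; last 2 first.
- by rewrite -natrX -natrM ltr0n muln_gt0 D0 expn_gt0 n0.
- by rewrite -natrM ltr0n muln_gt0 !double_gt0 !muln_gt0 !size_box_seq !expn_gt0.
rewrite -natrX -!natrM ler_nat.
have h k : (k <= n.*2)%N -> (size (box_seq d k) <= (5 * n) ^ d)%N.
  exact: size_box_seq_le.
rewrite (_ : 4 * 5 ^ (4 * d) * n ^ (4 * d) = 4 * ((5 * n) ^ d) ^ 4)%N; last first.
  by rewrite -expnM (mulnC d) expnMn mulnA.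
set X := ((5 * n) ^ d)%N in h *; rewrite -!muln2.
rewrite (_ : 4 * X ^ 4 = (X * X * 2) * (X * X * 2))%N; last by rewrite !expnS expn0; ring.
by rewrite !leq_mul//; apply: h; lia.
Qed.

Lemma conn_reflection n i x y :
  conn (box n) (reflection i x) (reflection i y) = conn (box n) x y.
Proof.
have [_ sR] := symE.
rewrite -[RHS](connect_pr_map Esym Eirr pc01 _ _ (@reflectionK d i)
  (@reflectionK d i) (sR i) (@finite_box d n)).
by congr (connect_pr _ _ _ _ _); apply/seteqP; split=> v /(box_reflection i).
Qed.

Lemma conn_tperm n i j x y :
  conn (box n) (col_perm (tperm i j) x) (col_perm (tperm i j) y) = conn (box n) x y.
Proof.
have [sP _] := symE.
have K : involutive (@col_perm int 1 d (tperm i j)).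
  by move=> v; apply/rowP => k; rewrite !mxE tpermK.
rewrite -[RHS](connect_pr_map Esym Eirr pc01 _ _ K K (sP _) (@finite_box d n)).
by congr (connect_pr _ _ _ _ _); apply/seteqP; split=> v /(box_col_perm (tperm i j)).
Qed.

Lemma reflection0 (i : 'I_d) : reflection i 0 = 0.
Proof. by apply/rowP => k; rewrite !mxE oppr0; case: ifP. Qed.

(** A boundary vertex has some coordinate within [rho] of a face; a transposition moves it to axis
    [i] and a reflection makes it positive. *)
Lemma exists_directed_seed n (q : R) u : box_boundary E n u -> q <= conn (box n) 0 u ->
  forall i, exists v, [/\ box n v, n%:Z < v 0 i + rho%:Z & q <= conn (box n) 0 v].
Proof.
move=> [bu [v [nbv uv]]] qu i.
have [j Hj] : exists j, n%:Z < `|v 0 j|.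
  apply: contrapT => H; apply: nbv => j; rewrite leNgt; apply/negP => lt.
  by apply: H; exists j.
have uj : n%:Z < `|u 0 j| + rho%:Z.
  by have := Hrho uv j; rewrite !rowE; mxlia.
pose u1 := col_perm (tperm i j) u.
have u1i : u1 0 i = u 0 j by rewrite mxE tpermL.
have bu1 : box n u1 by apply/box_col_perm.
have conn1 : conn (box n) 0 u1 = conn (box n) 0 u.
  rewrite -[RHS](conn_tperm n i j) /u1; congr (connect_pr _ _ _ _ _).
  by apply/rowP => k; rewrite !mxE.
have [ge|lt] := leP 0 (u 0 j).
  exists u1; split=> //; last by rewrite conn1.
  by rewrite u1i; move: uj; rewrite ger0_norm.
exists (reflection i u1); split; first exact/box_reflection.
  by rewrite mxE eqxx u1i; move: uj; rewrite ltr0_norm.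
by rewrite -[X in conn _ X _](reflection0 i) conn_reflection conn1.
Qed.

(* The seed ends at [u] near the face of [box n] orthogonal to axis [i];
   gluing it to its mirror image gives a connection along that axis. *)
Lemma exists_move : exists (a : R) (b n1 : nat), [/\ 0 < a, a <= 1, (0 < n1)%N &
  forall n, (n1 <= n)%N -> forall i (sg : bool) x, periodic m x -> exists t : int,
    [/\ (m%:Z %| t)%Z, n%:Z <= t <= (3 * n)%N%:Z &
      a / n%:R ^+ b <=
        conn (cbox x (4 * n)) x (x + (if sg then t else - t) *: delta_mx 0 i)]].
Proof.
have [a [b [n0 [a0 a1 Hseed]]]] := exists_seed.
have [N [c [c0 c1 Hc]]] := exists_local_connection m.
exists (a ^+ 2 * c), (b * 2)%N, (n0 + m + rho.*2 + N + 1)%N; split.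
- by rewrite mulr_gt0// exprn_gt0.
- by rewrite mulr_ile1// ?exprn_ge0 ?exprn_ile1 // ltW.
- by rewrite addn1.
move=> n nn i sg x px.
have n0n : (n0 <= n)%N by clear -nn; lia.
have [u0 bu0 qu0] := Hseed n n0n.
have [u [bu ui qu]] := exists_directed_seed bu0 qu0 i.
have n_gt0 : (0 < n)%N by clear -nn; lia.
have uin : u 0 i <= n%:Z by move: (bu i); clear; mxlia.
(* [t] is 2 [u 0 i] rounded down to a multiple of [m], so that the mirror image can be translated by
   a period. *)
have [t [tm tu]] : exists t : int, (m%:Z %| t)%Z /\ t <= u 0 i *+ 2 < t + m%:Z.
  move: (u 0 i *+ 2) => k; exists ((k %/ m%:Z)%Z * m%:Z); split; first exact: dvdz_mull.
  have := divz_eq k m%:Z; have := modz_ge0 k (_ : m%:Z != 0).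
  have := ltz_pmod k (_ : 0 < m%:Z).
  by clear -m_gt0; lia.
have tn : n%:Z <= t <= (2 * n)%N%:Z.
  by move: ui tu uin; clear -nn m_gt0; mxlia.
exists t; split=> //; first by clear -tn; lia.
pose e : 'rV[int]_d := t *: delta_mx 0 i.
have ej j : e 0 j = if j == i then t else 0.
  by rewrite !mxE eqxx /=; case: eqP; rewrite ?mulr1 ?mulr0.
have pe : periodic m e by move=> j; rewrite ej; case: ifP => // _; exact: dvdz0.
have conn0e : a ^+ 2 * c / n%:R ^+ (b * 2) <= conn (box (4 * n)) 0 e.
  (* The mirror image of the crossing, started at [e], ends at [u']: it agrees with [u] off axis
     [i], and along it differs by |t - 2 u_i| < m. *)
  pose u' := reflection i u + e.
  have fb : finite_set (box (4 * n) : set 'rV[int]_d) by exact: finite_box.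
  apply: le_trans (connect_pr_trans E pc01 0 u e fb).
  rewrite (_ : _ / _ = a / n%:R ^+ b * (c * (a / n%:R ^+ b))); last first.
    by rewrite exprM -exprVn; ring.
  have q0 : 0 <= a / n%:R ^+ b by rewrite divr_ge0 ?exprn_ge0// ltW.
  have nb v : cbox e n v -> box (4 * n) v.
    move=> ve; rewrite -(subrK e v); apply: (@box_mono _ (n + 2 * n)); first by clear; lia.
    apply: boxD => // j; rewrite ej; by case: ifP => _; clear -tn; lia.
  apply: ler_pM => //; first by rewrite mulr_ge0// ltW.
    by apply: le_trans qu _; apply: connect_pr_sub fb _; apply: box_mono; clear; lia.
  apply: le_trans (connect_pr_trans E pc01 u u' e fb); apply: ler_pM => //; first exact: ltW.
    apply: Hc => //; last first.
      move=> v uv; rewrite -(subrK u v).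
      apply: (@box_mono _ (N + n)); first by clear -nn; lia.
      exact: boxD.
    move=> j; rewrite /u' !row_addE row_oppE ej [reflection i u 0 j]mxE; move: tu.
    by case: eqP => [->|_]; clear -m_gt0; mxlia.
  rewrite connect_pr_sym; apply: (@le_trans _ _ (conn (cbox e n) e u')); last first.
    exact: connect_pr_sub.
  have := connect_pr_translate Hm Esym Eirr n 0 (reflection i u) pc01 pe.
  rewrite add0r => ->.
  by rewrite -[X in conn _ X _](reflection0 i) conn_reflection.
rewrite -/e.
have := connect_pr_translate Hm Esym Eirr (4 * n) 0
  ((if sg then t else - t) *: delta_mx 0 i) pc01 px.
rewrite add0r [_ *: _ + x]addrC => ->.
case: sg => //; rewrite (_ : - t *: _ = reflection i e).
  by rewrite -[X in conn _ X _](reflection0 i) conn_reflection.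
apply/rowP => j; rewrite [RHS]mxE ej !mxE eqxx /=.
by case: eqP => _; rewrite ?mulr1 ?mulr0.
Qed.

End Moves.

(** * Connections at logarithmically many scales *)

Section Rounds.
Variables (R : realType) (d : nat) (E : rel 'rV[int]_d) (m rho : nat) (i0 : 'I_d).
Hypotheses (m_gt0 : (0 < m)%N)
  (Hm : forall t : 'rV[int]_d, periodic m t -> translation E t)
  (Hrho : forall x y, E x y -> cbox x rho y)
  (connE : connected_graph E) (Esym : symmetric E) (Eirr : irreflexive E)
  (symE : coordinate_symmetric E).
Implicit Types (x y z u v w t : 'rV[int]_d).

Local Notation pc := (p_c R E).
Local Notation conn := (connect_pr E pc).

Let pc01 : 0 <= pc <= 1.
Proof. by have [] := p_c_infimum R m_gt0 Hrho connE Esym Eirr i0. Qed.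

(** The coordinates are treated in turn: one larger than M - n in absolute value is moved towards 0
    by between n and 3n. It cannot overshoot since 4n <= M, and the moves stay inside Q_r since M +
    4n <= r. *)
Lemma exists_round : exists (a : R) (b n1 : nat), [/\ 0 < a, a <= 1, (0 < n1)%N &
  forall r M n w, (n1 <= n)%N -> (4 * n <= M)%N -> (M + 4 * n <= r)%N ->
    periodic m w -> box M w -> exists w', [/\ periodic m w', box (M - n) w' &
      (a / r%:R ^+ b) ^+ d <= conn (box r) w w']].
Proof.
have [a [b [n1 [a0 a1 n1_gt0 Hmove]]]] :=
  exists_move R i0 m_gt0 Hm Hrho connE Esym Eirr symE.
exists a, b, n1; split=> // r M n w n1n nM Mr pw bw.
have n_gt0 : (0 < n)%N by exact: leq_trans n1n.
have r_gt0 : (0 < r)%N by clear -n_gt0 Mr; lia.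
pose q := a / r%:R ^+ b.
have q0 : 0 <= q by rewrite divr_ge0 ?exprn_ge0// ltW.
have q1 : q <= 1.
  by rewrite ler_pdivrMr ?exprn_gt0 ?ltr0n// mul1r (le_trans a1)// exprn_ege1// ler1n.
have fb : finite_set (box r : set 'rV[int]_d) by exact: finite_box.
suff H (l : seq 'I_d) : exists w', [/\ periodic m w', box M w',
    forall i, i \in l -> `|w' 0 i| <= (M - n)%N%:Z &
    q ^+ size l <= conn (box r) w w'].
  have [w' [pw' _ Hw' qw']] := H (enum 'I_d); exists w'; split=> //.
    by move=> i; apply: Hw'; rewrite mem_enum.
  by move: qw'; rewrite size_enum_ord.
elim: l => [|i l [w' [pw' bw' Hw' qw']]].
  exists w; split=> //; rewrite expr0 (connect_pr_refl Esym Eirr pc01)//.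
  by apply: box_mono bw; clear -Mr; lia.
have [le|gt] := leP `|w' 0 i| (M - n)%N%:Z.
  exists w'; split=> //.
    by move=> j; rewrite inE => /predU1P[->//|]; exact: Hw'.
  by apply: le_trans qw'; rewrite exprS ler_piMl ?exprn_ge0.
have [t [tm tn Ht]] := Hmove n n1n i (w' 0 i < 0) w' pw'.
set s : int := if _ then t else _ in Ht.
have sE : s = if w' 0 i < 0 then t else - t by [].
pose w'' := w' + s *: delta_mx 0 i.
have w''E j : w'' 0 j = if j == i then w' 0 i + s else w' 0 j.
  rewrite row_addE; have [->|ji] := eqVneq j i; rewrite !mxE ?eqxx ?mulr1//.
  by rewrite (negbTE ji) andbF mulr0 addr0.
have w''i : `|w'' 0 i| <= (M - n)%N%:Z.
  move: (bw' i) gt sE; rewrite w''E eqxx; move: (w' 0 i) => k.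
  by clear -tn nM; case: ifP; lia.
have MnM : (M - n <= M)%N by rewrite leq_subr.
exists w''; split.
- move=> j; rewrite w''E; case: eqP => [_|//]; rewrite rpredD//.
  by rewrite sE; case: ifP => // _; rewrite rpredN.
- move=> j; have [->|ji] := eqVneq j i.
    by apply: le_trans w''i _; rewrite lez_nat.
  by rewrite w''E (negbTE ji); exact: bw'.
- move=> j; rewrite inE; have [-> //|ji /=] := eqVneq j i.
  by rewrite w''E (negbTE ji); exact: Hw'.
apply: le_trans (connect_pr_trans E pc01 w w' w'' fb).
rewrite exprSr; apply: ler_pM => //; first exact: exprn_ge0.
apply: (@le_trans _ _ (a / n%:R ^+ b)).
  rewrite /q ler_pM2l// lef_pV2 ?posrE ?exprn_gt0 ?ltr0n//.
  by apply: lerXn2r; rewrite ?nnegrE ?ler_nat//; clear -Mr; lia.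
apply: le_trans Ht _; apply: connect_pr_sub => // v vw; rewrite -(subrK w' v).
by apply: (@box_mono _ (4 * n + M)); [clear -Mr; lia|exact: boxD].
Qed.

(** Two phases of at most [k] rounds: the distance to the boundary grows until [w] lies in the
    half-size box, then the distance to 0 shrinks. The depth [D] is 8 times the smallest admissible
    scale, so that even the first round has room. *)
Lemma exists_bulk_connection : exists (a c : R) (b D r0 : nat),
  [/\ 0 < a, a <= 1, 0 < c, c <= 1 &
    forall r k w, (r0 <= r)%N -> (16 ^ k * r <= 17 ^ k)%N ->
      periodic m w -> box (r - D) w ->
      (a / r%:R ^+ b) ^+ (d * (k + k)) * c <= conn (box r) w 0].
Proof.
have [a [b [n1 [a0 a1 n1_gt0 Hround]]]] := exists_round.
pose M0 := (8 * n1)%N.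
have [N [c [c0 c1 Hc]]] :=
  exists_local_connection R i0 m_gt0 Hm Hrho connE Esym Eirr M0.
exists a, c, b, M0, (M0 + M0 + N + 1)%N; split=> // r k0 w0 r0r krk pw0 bw0.
have r_gt0 : (0 < r)%N by clear -r0r; lia.
pose q := (a / r%:R ^+ b) ^+ d.
have q00 : 0 <= a / r%:R ^+ b by rewrite divr_ge0 ?exprn_ge0// ltW.
have q0 : 0 <= q by rewrite exprn_ge0.
have q1 : q <= 1.
  apply: exprn_ile1 => //.
  by rewrite ler_pdivrMr ?exprn_gt0 ?ltr0n// mul1r (le_trans a1)// exprn_ege1// ler1n.
have fb : finite_set (box r : set 'rV[int]_d) by exact: finite_box.
have near0 M w k : (M <= M0)%N -> box M w -> q ^+ k * c <= conn (box r) w 0.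
  move=> MM0 bw; apply: (@le_trans _ _ c).
    by apply: ler_piMl; [exact: ltW|exact: exprn_ile1].
  apply: Hc => //; first by apply: cbox_sym; rewrite cbox0; exact: box_mono bw.
  move=> v vw; rewrite -(subrK w v).
  by apply: (@box_mono _ (N + M)); [clear -r0r MM0; lia|exact: boxD].
(* With n = M / 8 rounded down and n >= 1, one has M <= 16n, so each round multiplies the radius by
   at most 15/16. *)
have shrink k M w : periodic m w -> box M w -> (2 * M <= r)%N ->
    (15 ^ k * M <= 16 ^ k * M0)%N -> q ^+ k * c <= conn (box r) w 0.
  elim: k M w => [|k IH] M w pw bw Mr kM.
    by apply: (near0 M) => //; rewrite !expn0 !mul1n in kM.
  have [MM0|M0M] := leqP M M0; first exact: near0 bw.
  pose n := (M %/ 8)%N.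
  have nM : (8 * n <= M < 8 * n + 8)%N.
    by have := divn_eq M 8; have := ltn_pmod M (isT : (0 < 8)%N); rewrite -/n; clear; lia.
  have n1n : (n1 <= n)%N by rewrite /M0 in M0M; clear -M0M nM; lia.
  have [w' [pw' bw' qw']] : exists w', [/\ periodic m w', box (M - n) w' &
      q <= conn (box r) w w'].
    by apply: Hround => //; clear -nM Mr; lia.
  apply: le_trans (connect_pr_trans E pc01 w w' 0 fb).
  rewrite exprS -mulrA; apply: ler_pM => //.
    by rewrite mulr_ge0 ?exprn_ge0// ltW.
  apply: (IH (M - n)%N) => //; first by clear -Mr; lia.
  have M' : (16 * (M - n) <= 15 * M)%N by clear -nM n1n n1_gt0; lia.
  rewrite -(@leq_pmul2l 16)// mulnCA (leq_trans (leq_mul (leqnn _) M'))//.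
  by rewrite mulnA -expnSr mulnA -expnS.
(* The same count serves both phases because 15 * 17 <= 16 * 16. *)
have rk : (15 ^ k0 * r <= 16 ^ k0)%N.
  rewrite -(@leq_pmul2l (16 ^ k0)) ?expn_gt0// mulnCA.
  apply: (leq_trans (leq_mul (leqnn _) krk)).
  by rewrite -!expnMn; case: (posnP k0) => [->//|k00]; rewrite leq_exp2r.
(* Now r - M is multiplied by at least 17/16 in each round; [k] bounds the rounds left in this phase
   and [k0] are reserved for shrinking. At k = 0 the invariant reads 2M <= r. *)
have grow k M w : periodic m w -> box M w -> (M + M0 <= r)%N ->
    (16 ^ k * r <= 17 ^ k * (2 * (r - M)))%N ->
    q ^+ (k + k0) * c <= conn (box r) w 0.
  elim: k M w => [|k IH] M w pw bw Mr kM.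
    rewrite add0n; apply: (shrink k0 M) => //.
      by move: kM; rewrite !expn0 !mul1n; clear -Mr; lia.
    rewrite (leq_trans _ (leq_pmulr _ _)) ?(leq_trans _ rk)//.
      by rewrite leq_mul//; clear -Mr; lia.
    by rewrite /M0 muln_gt0.
  have [Mr2|rM2] := leqP (2 * M) r.
    have -> : q ^+ (k.+1 + k0) * c = q ^+ k.+1 * (q ^+ k0 * c) by rewrite exprD mulrA.
    apply: (@le_trans _ _ (q ^+ k0 * c)).
      apply: ler_piMl; last exact: exprn_ile1.
      by rewrite mulr_ge0 ?exprn_ge0// ltW.
    apply: (shrink k0 M) => //.
    rewrite (leq_trans _ (leq_pmulr _ _)) ?(leq_trans _ rk)//.
      by rewrite leq_mul//; clear -Mr; lia.
    by rewrite /M0 muln_gt0.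
  pose n := ((r - M) %/ 8)%N.
  have nM : (8 * n <= r - M < 8 * n + 8)%N.
    by have := divn_eq (r - M) 8; have := ltn_pmod (r - M) (isT : (0 < 8)%N);
      rewrite -/n; clear; lia.
  have n1n : (n1 <= n)%N by rewrite /M0 in Mr; clear -Mr nM; lia.
  have [w' [pw' bw' qw']] : exists w', [/\ periodic m w', box (M - n) w' &
      q <= conn (box r) w w'].
    by apply: Hround => //; clear -nM Mr rM2; lia.
  apply: le_trans (connect_pr_trans E pc01 w w' 0 fb).
  rewrite addSn exprS -mulrA; apply: ler_pM => //.
    by rewrite mulr_ge0 ?exprn_ge0// ltW.
  apply: (IH (M - n)%N) => //; first by clear -Mr; lia.
  have M' : (17 * (r - M) <= 16 * (r - (M - n)))%N by clear -nM n1n n1_gt0 rM2 Mr; lia.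
  rewrite -(@leq_pmul2l 16)// mulnA -expnS (leq_trans kM)//.
  rewrite expnS -mulnA mulnCA [leqRHS]mulnCA leq_mul//.
  by rewrite mulnCA [leqRHS]mulnCA leq_mul.
rewrite exprM -/q; apply: (grow k0 (r - M0)%N) => //.
  by rewrite subnK//; clear -r0r; lia.
rewrite (leq_trans krk)// leq_pmulr//.
by rewrite subKn ?muln_gt0//; clear -r0r; lia.
Qed.

End Rounds.

(** * Number of rounds and total cost *)

Lemma up_log2_le_ln (R : realType) (r : nat) : (1 < r)%N ->
  (up_log 2 r)%:R * ln (2 : R) <= 2 * ln r%:R.
Proof.
move=> r1; have : (0 < up_log 2 r)%N by rewrite up_log_gt0.
have := @up_log_gtn 2 r isT r1; case: (up_log 2 r) => // j jr _.
have r0 : (0 < r)%N by exact: ltnW.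
have l2 : ln (2 : R) <= ln r%:R by rewrite ler_ln ?posrE ?ltr0n// ler_nat.
have lj : j%:R * ln (2 : R) <= ln r%:R.
  rewrite mulr_natl -lnXn// -natrX ler_ln ?posrE ?ltr0n ?expn_gt0// ler_nat.
  exact: ltnW.
rewrite -natr1 mulrDl mul1r; clear -lj l2; lra.
Qed.

(* [a / r ^ b] is the cost of one round and [32 * up_log 2 r] bounds their number. *)
Lemma rounds_cost (R : realType) (a : R) (b d : nat) : 0 < a -> a <= 1 ->
  exists2 C, 0 < C & forall r, (1 < r)%N ->
    expR (- (C * ln r%:R ^+ 2)) <=
      (a / r%:R ^+ b) ^+ (d * (16 * up_log 2 r + 16 * up_log 2 r)).
Proof.
move=> a0 a1.
pose l : R := ln 2; pose al : R := - ln a.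
have l2 : 0 < l by rewrite ln_gt0// ltr1n.
have la : 0 <= al by rewrite oppr_ge0 ln_le0.
(* The exponent is at most 64 d L / l with L = ln r, and each factor contributes b L + al <= (b + al
   / l) L since l <= L; the added 1 ensures C > 0. *)
pose C : R := 64 * d%:R / l * (b%:R + al / l) + 1.
have C0 : 0 < C.
  by rewrite ltr_wpDl// mulr_ge0// ?addr_ge0 ?divr_ge0 ?mulr_ge0// ltW.
exists C => // r r1; set L := ln r%:R; set k := (d * _)%N.
have r0 : 0 < (r%:R : R) by rewrite ltr0n ltnW.
have Ll : l <= L by rewrite ler_ln ?posrE ?ler_nat.
have L0 : 0 < L by exact: lt_le_trans Ll.
rewrite -[X in _ <= X]lnK ?posrE ?exprn_gt0 ?divr_gt0 ?exprn_gt0// ler_expR.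
rewrite lnXn ?divr_gt0 ?exprn_gt0// ln_div ?posrE ?exprn_gt0// lnXn// -/L.
have J0 : 0 <= (up_log 2 r)%:R :> R by [].
have Jl : (up_log 2 r)%:R <= 2 * L / l.
  by rewrite ler_pdivlMr//; exact: up_log2_le_ln.
rewrite -[X in _ <= X]mulr_natl.
have kE : k%:R = 32 * d%:R * (up_log 2 r)%:R :> R.
  by rewrite /k -mulnDl natrM natrM; ring.
rewrite kE lerNl.
have -> : - (32 * d%:R * (up_log 2 r)%:R * (ln a - L *+ b)) =
    32 * d%:R * ((up_log 2 r)%:R * (b%:R * L + al)) by rewrite /al -mulr_natl; ring.
have bal : b%:R * L + al <= (b%:R + al / l) * L.
  rewrite mulrDl lerD2l mulrAC ler_pdivlMr//; exact: ler_wpM2l.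
have d0 : 0 <= 32 * d%:R :> R by rewrite mulr_ge0.
apply: (@le_trans _ _ (32 * d%:R * (2 * L / l * ((b%:R + al / l) * L)))).
  apply: ler_wpM2l => //; apply: ler_pM => //.
  by rewrite addr_ge0// mulr_ge0// ltW.
rewrite [leRHS](_ : _ = 32 * d%:R * (2 * L / l * ((b%:R + al / l) * L)) + L ^+ 2).
  by rewrite lerDl sqr_ge0.
by rewrite /C; ring.
Qed.

(** Bernoulli's inequality in integers; at n = k + 1 it says that (1 + 1/n)^n >= 2. *)
Lemma expn_bernoulli (n k : nat) : (n ^ k.+1 + k.+1 * n ^ k <= n.+1 ^ k.+1)%N.
Proof.
elim: k => [|k IH]; first by rewrite !expn1 expn0 muln1 addn1.
rewrite [leqRHS]expnS (leq_trans _ (leq_mul (leqnn _) IH))//.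
by rewrite !expnS; move: (n ^ k)%N => X; nia.
Qed.

(** Every [n] factors 1 + 1/n gain a factor 2. With n = 16 this supplies the number of rounds of
    each phase. *)
Lemma up_log2_rounds (n r : nat) : (0 < n)%N -> (1 < r)%N ->
  (n ^ (n * up_log 2 r) * r <= n.+1 ^ (n * up_log 2 r))%N.
Proof.
move=> n0 r1; have j0 : (0 < up_log 2 r)%N by rewrite up_log_gt0.
rewrite !expnM (leq_trans (leq_mul (leqnn _) (up_logP r (isT : (1 < 2)%N))))//.
rewrite -expnMn leq_exp2r//; case: n n0 => // n _.
by rewrite (leq_trans _ (expn_bernoulli n.+1 n))// -expnS muln2 addnn.
Qed.

(** Reachability of [z] inside the box is what gives the open connection a chance; connectedness of
    [E] makes the set defining [p_c] nonempty and yields the bounded local paths. *)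
Theorem lemma1p1 (R : realType) (d : nat) (E : rel 'rV[int]_d)
    (latticeE : lattice R E) (connectedE : connected_graph E)
    (symE : coordinate_symmetric E) :
  exists C c : R,
    [/\ 0 < C, 0 < c &
      forall (r : nat) (z : 'rV[int]_d), (0 < r)%N ->
        box_boundary E r z -> joined E (box r) 0 z ->
        ((c * expR (- (C * (ln r%:R) ^+ 2)))%:E <=
          percolation E (p_c R E) (open_connection (box r) 0%R z))%E].
Proof.
(* In dimension 0 every vertex is in the box, which has no boundary. *)
have [[i0]|nI] := pselect (inhabited 'I_d); last first.
  exists 1, 1; split=> // r z _ [_ [x [nbx _]]] _; exfalso; apply: nbx => i.
  by exfalso; apply: nI; exists.
have [Esym Eirr fE _] := latticeE.
have [m m_gt0 Hm] := exists_period symE i0 latticeE.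
have [rho Hrho] := exists_range m_gt0 Hm fE.
have [pc01 _] := p_c_infimum R m_gt0 Hrho connectedE Esym Eirr i0.
have pc_gt0 := p_c_gt0 R m_gt0 Hm Hrho connectedE Esym Eirr i0.
have /andP[pc0 pc1] := pc01.
have [a [c [b [D [r0 [a0 a1 c0 c1 Hbulk]]]]]] :=
  exists_bulk_connection R i0 m_gt0 Hm Hrho connectedE Esym Eirr symE.
have [N [R0 Hin]] := exists_inward_path m_gt0 Hm Hrho Esym D.
have [C C0 HC] := rounds_cost b d a0 a1.
pose R1 := (r0 + R0 + 2)%N; pose K := size (box_seq d R1).
pose pc := p_c R E; rewrite -/pc in pc_gt0 pc0 pc1 pc01 *.
(* For r > R1, [pc ^+ N] pays for the inward path and [c] for the last local connection; for r <=
   R1, [pc ^+ K] pays for a simple path, which has at most K edges. All factors are at most 1, so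
   their product covers both cases. *)
exists C, (c * pc ^+ N * pc ^+ K); split=> //.
  by rewrite !mulr_gt0// exprn_gt0.
move=> r z r_gt0 _ z0; have fb : finite_set (box r : set 'rV[int]_d) by exact: finite_box.
rewrite /percolation prE//; last first.
  by apply: finite_event_measurable; exact: finite_event_connection.
rewrite lee_fin -[pr _ _]/(connect_pr E pc (box r) 0 z).
have e1 : expR (- (C * ln r%:R ^+ 2)) <= 1 :> R.
  by rewrite -expR0 ler_expR oppr_le0 mulr_ge0 ?sqr_ge0// ltW.
have e0 : 0 <= expR (- (C * ln r%:R ^+ 2)) :> R by exact: expR_ge0.
have pN0 : 0 <= pc ^+ N by rewrite exprn_ge0.
have pN1 : pc ^+ N <= 1 by rewrite exprn_ile1.
have pK0 : 0 <= pc ^+ K by rewrite exprn_ge0.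
have pK1 : pc ^+ K <= 1 by rewrite exprn_ile1.
have [rR1|R1r] := leqP r R1.
  have : joined_le K E (box r) 0 z.
    by apply: joined_le_card z0; rewrite -mem_box_seq; exact: box_mono.
  move=> /(connect_pr_path Esym Eirr pc01 fb); apply: le_trans.
  apply: (@le_trans _ _ (1 * pc ^+ K * 1)); last by rewrite mul1r mulr1.
  apply: ler_pM => //; first by rewrite !mulr_ge0// ltW.
  by apply: ler_wpM2r => //; rewrite mulr_ile1// ltW.
have R0r : (R0 <= r)%N by rewrite /R1 in R1r; clear -R1r; lia.
have r0r : (r0 <= r)%N by rewrite /R1 in R1r; clear -R1r; lia.
have r1 : (1 < r)%N by rewrite /R1 in R1r; clear -R1r; lia.
have [w [pw bw] zw] := Hin r z R0r z0.
have h1 := Hbulk r _ w r0r (up_log2_rounds (isT : (0 < 16)%N) r1) pw bw.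
have h2 := connect_pr_path Esym Eirr pc01 fb zw.
rewrite connect_pr_sym; apply: le_trans (connect_pr_trans E pc01 z w 0 fb).
set e := expR _ in e0 e1 *.
apply: (@le_trans _ _ (pc ^+ N * (e * c))).
  rewrite mulrAC; apply: (@le_trans _ _ (c * pc ^+ N * e)).
    by apply: ler_piMr => //; rewrite !mulr_ge0// ltW.
  by rewrite (mulrC c) -mulrA (mulrC c).
apply: ler_pM => //; first by rewrite mulr_ge0// ltW.
apply: le_trans h1; apply: ler_wpM2r; [exact: ltW|exact: HC].
Qed.
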